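(* Let $F$ be a box-like self-affine set of separated type, the attractor of an IFS $\{S_i\}_{i\in\mathcal I}$ as described in the context, which satisfies the rectangular open set condition (ROSC). Furthermore, assume that each map $S_i$ in the IFS has singular values $\alpha_1(i)\ge\alpha_2(i)$, where the larger singular value $\alpha_1(i)$ corresponds to contracting in the horizontal direction (that is, the rectangle $S_i([0,1]^2)$ has base of length $\alpha_1(i)$ and height $\alpha_2(i)$). Then $$\dim_{\mathrm P}F=\dim_{\mathrm B}F=s,$$ where $s$ is the unique solution of $$\sum_{i\in\mathcal I}\alpha_1(i)^{s_1}\,\alpha_2(i)^{s-s_1}=1,$$ with $s_1=\dim_{\mathrm B}\pi_1(F)$. Furthermore, if $s_1=1$, then $s$ is the affinity dimension of the IFS.
   Context: Box-like sets: $\mathcal I$ is a finite index set with $|\mathcal I|\ge 2$, and $\{S_i\}_{i\in\mathcal I}$ is an iterated function system (IFS) of maps $S_i:\mathbb R^2\to\mathbb R^2$ of the form $S_i=T_i\circ L_i+t_i$, where $T_i=\begin{pmatrix}a_i&0\\0&b_i\end{pmatrix}$ with $a_i,b_i\in(0,1)$, $L_i$ is a linear isometry of the plane with $L_i([-1,1]^2)=[-1,1]^2$, and $t_i\in\mathbb R^2$. The box-like self-affine set $F$ is the unique non-empty compact set with $F=\bigcup_{i\in\mathcal I}S_i(F)$. $F$ is of separated type if no $S_i$ maps horizontal lines to vertical lines, i.e. every $S_i$ maps horizontal lines to horizontal lines. $\alpha_1(i)\ge\alpha_2(i)$ are the singular values of the linear part of $S_i$. $\pi_1(x,y)=x$;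 the box dimension of $\pi_1(F)$ exists. ROSC: there is a non-empty open rectangle $R=(a,b)\times(c,d)\subset\mathbb R^2$ such that the sets $S_i(R)$, $i\in\mathcal I$, are pairwise disjoint subsets of $R$. Affinity dimension: for a linear map $A:\mathbb R^2\to\mathbb R^2$ with singular values $\alpha_1\ge\alpha_2$, the singular value function is $\phi^0(A)=1$, $\phi^s(A)=\alpha_1^s$ for $0<s\le1$, $\phi^s(A)=\alpha_1\alpha_2^{s-1}$ for $1<s\le2$, and $\phi^s(A)=(\alpha_1\alpha_2)^{s/2}$ for $s>2$. With $A_i=T_i\circ L_i$ the linear part of $S_i$, the affinity dimension is $$\inf\Big\{s\ge0:\sum_{k=1}^\infty\ \sum_{(i_1,\dots,i_k)\in\mathcal I^k}\phi^s(A_{i_1}\circ\cdots\circ A_{i_k})<\infty\Big\}.$$ $\dim_{\mathrm P}$ is packing dimension and $\dim_{\mathrm B}$ box-counting dimension; an equality involving $\dim_{\mathrm B}F$ includes the assertion that the lower and upper box dimensions of $F$ coincide. *)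

(* Defs.v *)
From HB Require Import structures.
From mathcomp Require Import all_boot all_order all_algebra.
From mathcomp Require Import all_classical all_reals all_analysis.

Set Implicit Arguments.
Unset Strict Implicit.
Unset Printing Implicit Defensive.

Import Order.TTheory GRing.Theory Num.Theory.
Import numFieldNormedType.Exports.

Local Open Scope classical_set_scope.
Local Open Scope ring_scope.

(* Points of the plane are column vectors p : 'cV[R]_2, with coordinates
   x = p 0 0 and y = p 1 0.  The norm that the library puts on 'cV[R]_2 is the
   sup norm (same topology), so the Euclidean one is introduced here. *)

Definition eucl_norm (R : realType) n (v : 'cV[R]_n) : R :=
  Num.sqrt (\sum_i v i 0 ^+ 2).

Definition eucl_dist (R : realType) n (x y : 'cV[R]_n) : R := eucl_norm (x - y).

Definition real_dist (R : realType) (x y : R) : R := `|x - y|.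

Section Dimensions.
Variables (R : realType) (T : Type) (dist : T -> T -> R).
Local Open Scope ereal_scope.

Definition diam_le (U : set T) (delta : R) : Prop :=
  forall x y, U x -> U y -> (dist x y <= delta)%R.

(* Smallest number of sets of diameter at most delta needed to cover E
   (+oo when no finite cover exists). *)
Definition covering_number (E : set T) (delta : R) : \bar R :=
  ereal_inf [set n%:R%:E | n in [set n : nat |
    exists U : 'I_n -> set T,
      (forall k, diam_le (U k) delta) /\ E `<=` \bigcup_k U k]].

Definition box_ratio (E : set T) (delta : R) : \bar R :=
  lne (covering_number E delta) * ((- ln delta)^-1)%:E.

Definition lower_box_dim (E : set T) : \bar R :=
  limf_einf (box_ratio E) 0^'+.

Definition upper_box_dim (E : set T) : \bar R :=
  limf_esup (box_ratio E) 0^'+.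

Definition has_box_dim (E : set T) (s : R) : Prop :=
  lower_box_dim E = s%:E /\ upper_box_dim E = s%:E.

Definition dist_cball (x : T) (r : R) : set T := [set y | (dist x y <= r)%R].

(* Supremum of sum_k |B_k|^s over the finite or countable families of pairwise
   disjoint closed balls B_k with centres in E and radii at most delta; the
   family is indexed by a set D of naturals, and |B_k| is taken to be twice the
   radius, which is the diameter of a ball of a Euclidean space. *)
Definition packing_delta (s : R) (E : set T) (delta : R) : \bar R :=
  ereal_sup [set v | exists (D : set nat) (x : nat -> T) (r : nat -> R),
    [/\ forall k, D k -> E (x k),
        forall k, D k -> (0 < r k <= delta)%R,
        trivIset D (fun k => dist_cball (x k) (r k)) &
        v = \esum_(k in D) ((2 * r k) `^ s)%:E]].

Definition packing_premeasure (s : R) (E : set T) : \bar R :=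
  lim (packing_delta s E delta @[delta --> 0^'+]).

Definition packing_measure (s : R) (E : set T) : \bar R :=
  ereal_inf [set \sum_(0 <= k <oo) packing_premeasure s (U k) |
             U in [set U : nat -> set T | E `<=` \bigcup_k U k]].

Definition packing_dim (E : set T) : \bar R :=
  ereal_inf [set s%:E | s in [set s : R |
    (0 <= s)%R /\ packing_measure s E = 0]].

End Dimensions.

Section Plane.
Variable R : realType.

(* The largest and smallest square roots of eigenvalues of A^T A. *)
Definition sing1 (A : 'M[R]_2) : R :=
  sup [set Num.sqrt l | l in [set l | eigenvalue (A^T *m A) l]].

Definition sing2 (A : 'M[R]_2) : R :=
  inf [set Num.sqrt l | l in [set l | eigenvalue (A^T *m A) l]].

Definition sing_fun (s : R) (A : 'M[R]_2) : R :=
  if s == 0 then 1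
  else if s <= 1 then sing1 A `^ s
  else if s <= 2 then sing1 A * sing2 A `^ (s - 1)
  else (sing1 A * sing2 A) `^ (s / 2).

(* The product over a word w is noncommutative and taken from left to right,
   so it is the matrix of A_{w_1} o ... o A_{w_k}. *)
Definition affinity_dim (I : finType) (A : I -> 'M[R]_2) : \bar R :=
  ereal_inf [set s%:E | s in [set s : R | 0 <= s /\
    (\sum_(1 <= k <oo)
       (\sum_(w : k.-tuple I) sing_fun s (\prod_(i <- w) A i))%R%:E < +oo)%E]].

Definition closed_rect (x1 x2 y1 y2 : R) : set 'cV[R]_2 :=
  [set p | x1 <= p 0 0 <= x2 /\ y1 <= p 1 0 <= y2].

Definition open_rect (x1 x2 y1 y2 : R) : set 'cV[R]_2 :=
  [set p | x1 < p 0 0 < x2 /\ y1 < p 1 0 < y2].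

Definition horizontal_line (l : set 'cV[R]_2) : Prop :=
  exists c : R, l = [set p | p 1 0 = c].

Definition proj1_set (E : set 'cV[R]_2) : set R := [set p 0 0 | p in E].

Definition square_isometry (L : 'M[R]_2) : Prop :=
  (forall x : 'cV[R]_2, eucl_norm (L *m x) = eucl_norm x) /\
  mulmx L @` closed_rect (-1) 1 (-1) 1 = closed_rect (-1) 1 (-1) 1.

Definition diag2 (a b : R) : 'M[R]_2 :=
  diag_mx (\row_j (if j == 0 then a else b)).

Definition affine_map (A : 'M[R]_2) (t x : 'cV[R]_2) : 'cV[R]_2 := A *m x + t.

Definition is_attractor (I : finType) (S : I -> 'cV[R]_2 -> 'cV[R]_2)
    (F : set 'cV[R]_2) : Prop :=
  [/\ F !=set0, compact F & F = \bigcup_i (S i @` F)].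

Definition separated_type (I : finType) (S : I -> 'cV[R]_2 -> 'cV[R]_2) : Prop :=
  forall i l, horizontal_line l -> horizontal_line (S i @` l).

Definition ROSC (I : finType) (S : I -> 'cV[R]_2 -> 'cV[R]_2) : Prop :=
  exists a b c d : R, let U := open_rect a b c d in
    [/\ a < b, c < d, forall i, S i @` U `<=` U &
        trivIset [set: I] (fun i => S i @` U)].

(* S contracts by sing1 in the horizontal and by sing2 in the vertical
   direction, A being the linear part of S. *)
Definition horizontal_sing1 (A : 'M[R]_2) (S : 'cV[R]_2 -> 'cV[R]_2) : Prop :=
  exists x y : R, S @` closed_rect 0 1 0 1 =
    closed_rect x (x + sing1 A) y (y + sing2 A).

End Plane.

(* Main.v *)
Require Import Defs.
From HB Require Import structures.
From mathcomp Require Import all_boot all_order all_algebra.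
From mathcomp Require Import all_classical all_reals all_analysis.
From mathcomp Require Import ring lra.

Set Implicit Arguments.
Unset Strict Implicit.
Unset Printing Implicit Defensive.

Import Order.TTheory GRing.Theory Num.Theory.
Import numFieldNormedType.Exports.

Local Open Scope classical_set_scope.
Local Open Scope ring_scope.

(** Each linear part is diagonal (isometry_diagonal), so a composition S_w of the maps
    along a word w scales horizontal distances by width w and vertical ones by
    height w, both multiplicative in w, with height w <= width w.

    Box dimension.  Fix a scale d and follow every branch of the word tree until
    its height drops to about d; this is the list cut n d.  At scale d the
    cylinder S_w(F) of such a word is indistinguishable from a horizontal copy
    of pi_1(F) stretched by width w: covering it costs as many sets as covering
    pi_1(F) at scale d / width w, about (width w / d)^s1.  As height w is
    comparable to d, this is weight w * d^(-s) with
    weight w = width w ^ s1 * height w ^ (s - s1).  The defining equation of s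
    says that weight is a probability weight on the alphabet, so it sums to 1
    over the cut and the total cost is d^(-s) up to a factor d^(-e) with e
    arbitrarily small.
    - These sets cover F (cover_F_upper), which bounds the upper box dimension
      (box_le_F).
    - For the lower bound (cover_F_lower, box_ge_F) a set of diameter d must not
      serve many cylinders at once.  By the rectangular open set condition the
      images of the open rectangle U along the cut are disjoint; they are
      rectangles at least about d high and wide, and F lies in the closure of U.
      So the cylinders met by a set of diameter d have pairwise distinct points
      of a fixed-size grid of mesh comparable to d in their cells, and their
      number is bounded (count_cells).

    Packing dimension.  It never exceeds the upper box dimension
    (packing_dim_le): balls of a packing with radii in a dyadic range have
    separated centres.  Conversely, a set of finite packing premeasure at
    exponent u, and its closure, have upper box dimension at most u.  Were
    packing_dim F < s, countably many such closures with u < s would cover F.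
    None contains a cylinder, because cylinders have box dimension s; so one
    picks nested cylinders, the k-th at positive distance from the k-th closure,
    and compactness yields a point of F in none of them (packing_dim_F_ge).

    Affinity dimension.  The singular values of a product are the products of
    the singular values, so the k-th level sum of the singular value function
    is G(u)^k, where G(u) is its sum over the alphabet, and the series converges
    exactly when G(u) < 1.  If s1 = 1 then 1 <= s <= 2, since F projects onto a
    set of dimension 1 and lies in the plane; hence G(s) = 1 is the defining
    equation of s, while G(u) >= 1 for u < s and G(u) < 1 for u > s
    (affinity_dim_diag2). *)

(** * Covers and box dimensions *)

(** Covers are handled as a relation between a set, a scale and a number of
    pieces, which avoids the infimum and the value +oo of covering_number. *)
Definition cover_by (R : realType) (T : Type) (dist : T -> T -> R)
    (E : set T) (delta : R) (n : nat) : Prop :=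
  exists U : 'I_n -> set T,
    (forall k, diam_le dist (U k) delta) /\ E `<=` \bigcup_k U k.

(** [box_le] and [box_ge] bound the upper box dimension above and the lower box
    dimension below; see [upper_box_dimP] and [lower_box_dimP]. *)
Definition box_le (R : realType) (T : Type) (dist : T -> T -> R)
    (E : set T) (s : R) : Prop :=
  forall e, 0 < e -> exists C d0, [/\ 0 < C, 0 < d0 &
    forall d, 0 < d < d0 ->
      exists n, cover_by dist E d n /\ n%:R <= C * d `^ (- (s + e))].

Definition box_ge (R : realType) (T : Type) (dist : T -> T -> R)
    (E : set T) (s : R) : Prop :=
  forall e, 0 < e -> exists c d0, [/\ 0 < c, 0 < d0 &
    forall d n, 0 < d < d0 -> cover_by dist E d n ->
      c * d `^ (- (s - e)) <= n%:R].

Section Covers.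
Variables (R : realType) (T : Type) (dist : T -> T -> R).
Implicit Types (E : set T) (s d : R).

Lemma cover_by_sub E E' d n :
  E' `<=` E -> cover_by dist E d n -> cover_by dist E' d n.
Proof. by move=> EE' [U [Ud EU]]; exists U; split=> // x /EE' /EU. Qed.

Lemma diam_le_mon (U : set T) d d' : d <= d' -> diam_le dist U d -> diam_le dist U d'.
Proof. by move=> dd' H x y Ux Uy; exact: le_trans (H _ _ Ux Uy) dd'. Qed.

Lemma cover_by_mon E d d' n :
  d <= d' -> cover_by dist E d n -> cover_by dist E d' n.
Proof.
by move=> dd' [U [Ud EU]]; exists U; split=> // k; exact: diam_le_mon (Ud k).
Qed.

Lemma cover_by_fin (J : finType) (P : {set J}) (U : J -> set T) E d :
  (forall j, j \in P -> diam_le dist (U j) d) ->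
  (forall x, E x -> exists2 j, j \in P & U j x) -> cover_by dist E d #|P|.
Proof.
move=> Ud EU; exists (fun k => U (enum_val k)); split.
  by move=> k; apply: Ud; exact: enum_valP.
by move=> x /EU[j jP Ux]; exists (enum_rank_in jP j) => //; rewrite enum_rankK_in.
Qed.

Lemma cover_by0 d : cover_by dist set0 d 0.
Proof. by exists (fun _ => set0); split=> // k; case: k. Qed.

Lemma cover_by_setU E1 E2 d n1 n2 : cover_by dist E1 d n1 ->
  cover_by dist E2 d n2 -> cover_by dist (E1 `|` E2) d (n1 + n2).
Proof.
move=> [U1 [d1 c1]] [U2 [d2 c2]].
exists (fun k => match fintype.split k with inl j => U1 j | inr j => U2 j end).
split=> [k|x [/c1|/c2] [j _ Uj]]; first by case: fintype.split.
  by exists (lshift n2 j) => //; rewrite (unsplitK (inl _ j)).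
by exists (rshift n1 j) => //; rewrite (unsplitK (inr _ j)).
Qed.

Lemma cover_by_bigcup (J : eqType) (W : seq J) (E : J -> set T) (n : J -> nat) d :
  (forall w, w \in W -> cover_by dist (E w) d (n w)) ->
  cover_by dist [set x | exists2 w, w \in W & E w x] d (\sum_(w <- W) n w).
Proof.
elim: W => [|w W IH] H.
  by rewrite big_nil; apply: cover_by_sub (cover_by0 d) => x [].
rewrite big_cons.
have c1 := H w (mem_head _ _).
have c2 : cover_by dist [set x | exists2 w, w \in W & E w x] d (\sum_(j <- W) n j).
  by apply: IH => v vW; apply: H; rewrite inE vW orbT.
apply: cover_by_sub (cover_by_setU c1 c2) => x [v].
by rewrite inE => /orP[/eqP->|vW] Ex; [left|right; exists v].
Qed.

Lemma cover_by_gt0 E d n : E !=set0 -> cover_by dist E d n -> (0 < n)%N.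
Proof. by move=> [x Ex] [U [_ /(_ _ Ex)[k _ _]]]; case: k => /= m /(leq_ltn_trans _); apply. Qed.

Lemma covering_number_lt E d x : (covering_number dist E d < x%:E)%E ->
  exists n, cover_by dist E d n /\ n%:R < x.
Proof. by move=> /ereal_inf_lt[_ [n nE <-]]; rewrite lte_fin => nx; exists n. Qed.

Lemma covering_number_le E d n :
  cover_by dist E d n -> (covering_number dist E d <= n%:R%:E)%E.
Proof. by move=> H; apply: ereal_inf_lbound; exists n. Qed.

(** Dividing by - ln d and taking the logarithm are both increasing; the cases of
    covering number 0 and +oo agree with the conventions for [lne]. *)
Lemma box_ratio_lt E d y : 0 < d < 1 ->
  (box_ratio dist E d < y%:E)%E = (covering_number dist E d < (d `^ (- y))%:E)%E.
Proof.
move=> /andP[d0 d1]; rewrite /box_ratio.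
have l0 : 0 < - ln d by rewrite oppr_gt0 ln_lt0// d0.
have p0 : 0 < d `^ (- y) by rewrite powR_gt0.
have : (0 <= covering_number dist E d)%E.
  by apply: le_ereal_inf_tmp => _ [n _ <-]; rewrite lee_fin.
case: covering_number => [r| |]//=; last first.
  by move=> _; rewrite gt0_mulye ?lte_fin ?invr_gt0// !ltNge !leey.
rewrite lee_fin le_eqVlt => /predU1P[<-|r0].
  by rewrite lexx gt0_mulNye ?lte_fin ?invr_gt0// p0 ltNyr.
rewrite leNgt r0/= -EFinM !lte_fin ltr_pdivrMr//.
by rewrite -(ltr_ln (x:=r)) ?posrE// ln_powR mulrN mulNr.
Qed.

End Covers.

Section LimitsAtZero.
Variable R : realType.

Lemma at_right0P (V : set R) :
  (0^'+) V <-> exists2 d0 : R, 0 < d0 & forall d, 0 < d < d0 -> V d.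
Proof.
split=> [[e /= e0 H]|[d0 d00 H]].
  by exists e => // d /andP[d0 de]; apply: H; rewrite //= sub0r normrN gtr0_norm.
exists d0 => //= d; rewrite /ball_ /= sub0r normrN => dd d_gt0; apply: H.
by apply/andP; split=> //; rewrite -(gtr0_norm d_gt0).
Qed.

Lemma limf_einf_le_esup (f : R -> \bar R) :
  (limf_einf f 0^'+ <= limf_esup f 0^'+)%E.
Proof.
rewrite limf_einfE limf_esupE.
apply: ge_ereal_sup => _ [V FV <-]; apply: le_ereal_inf_tmp => _ [W FW <-].
have /at_right0P[d0 d00 H] : (0^'+) (V `&` W) by exact: filterI.
have [|Vd Wd] := H (d0 / 2); first by lra.
apply: (@le_trans _ _ (f (d0 / 2))).
  by apply: ereal_inf_lbound; exists (d0 / 2).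
by apply: ereal_sup_ubound; exists (d0 / 2).
Qed.

Lemma powR_lt (a x y : R) : 1 < a -> x < y -> a `^ x < a `^ y.
Proof.
move=> a1 xy; rewrite /powR gt_eqF ?(lt_trans ltr01)// ltr_expR ltr_pM2r//.
exact: ln_gt0.
Qed.

Lemma powR_gt (a x y : R) : 0 < a < 1 -> x < y -> a `^ y < a `^ x.
Proof.
move=> a01 xy; have /andP[a0 _] := a01.
by rewrite /powR gt_eqF// ltr_expR ltr_nM2r// ln_lt0.
Qed.

Lemma powR_expR (a x : R) : 0 < a -> a `^ x = expR (x * ln a).
Proof. by move=> a0; rewrite /powR gt_eqF. Qed.

Lemma powR_between (l x h t : R) : 0 < l -> l <= x <= h ->
  Num.min (l `^ t) (h `^ t) <= x `^ t <= Num.max (l `^ t) (h `^ t).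
Proof.
move=> l0 /andP[lx xh].
have x0 := lt_le_trans l0 lx; have h0 := lt_le_trans x0 xh.
rewrite ge_min le_max !powR_expR// !ler_expR.
have lnlx : ln l <= ln x by rewrite ler_ln.
have lnxh : ln x <= ln h by rewrite ler_ln.
have [t0|/ltW t0] := leP 0 t.
  by rewrite (ler_wpM2l t0 lnlx) (ler_wpM2l t0 lnxh) orbT.
by rewrite (ler_wnM2l t0 lnlx) (ler_wnM2l t0 lnxh) orbT.
Qed.

(** A multiplicative constant is absorbed by an arbitrarily small power of d. *)
Lemma powR_dominates (C e : R) : 0 < C -> 0 < e ->
  exists2 d0, 0 < d0 < 1 & forall d, 0 < d < d0 -> C < d `^ (- e).
Proof.
move=> C0 e0; exists (Num.min (1 / 2) (C `^ (- e^-1))).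
  by rewrite lt_min powR_gt0// gt_min; apply/andP; split; [|apply/orP; left]; lra.
move=> d /andP[d0]; rewrite lt_min => /andP[_ dC].
rewrite powRN -[ltLHS]invrK ltf_pV2 ?posrE ?invr_gt0 ?powR_gt0//.
have := gt0_ltr_powR e0 (ltW d0) (powR_ge0 _ _) dC.
by rewrite -powRrM mulNr mulVf ?gt_eqF// powRN powRr1// ltW.
Qed.

End LimitsAtZero.

Section BoxDimension.
Variables (R : realType) (T : Type) (dist : T -> T -> R).
Implicit Types (E : set T) (s d : R).

Lemma upper_box_dimP E s :
  (upper_box_dim dist E <= s%:E)%E <-> box_le dist E s.
Proof.
rewrite /upper_box_dim limf_esupE; split=> [H e e0|H].
  have /(le_lt_trans H) : (s%:E < (s + e)%:E)%E by rewrite lte_fin ltrDl.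
  move=> /ereal_inf_lt[_ [V /at_right0P[d0 d00 HV] <-]] supV.
  exists 1, (Num.min d0 1); split=> //; first by rewrite lt_min d00 ltr01.
  move=> d; rewrite lt_min andbA => /andP[dd0 d1].
  have d_gt0 : 0 < d by case/andP: dd0.
  have : (box_ratio dist E d < (s + e)%:E)%E.
    by apply: le_lt_trans supV; apply: ereal_sup_ubound; exists d => //; exact: HV.
  rewrite box_ratio_lt ?d_gt0// => /covering_number_lt[n [En nd]].
  by exists n; split=> //; rewrite mul1r ltW.
apply/lee_addgt0Pr => e e0.
have e20 : 0 < e / 2 by rewrite divr_gt0.
have [C [d0 [C0 d00 Hd]]] := H _ e20.
have [d1 /andP[d10 d11] Hd1] := powR_dominates C0 e20.
apply: (@le_trans _ _ (ereal_sup (box_ratio dist E @` [set d | 0 < d < Num.min d0 d1]))).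
  apply: ereal_inf_lbound; exists [set d | 0 < d < Num.min d0 d1] => //.
  by apply/at_right0P; exists (Num.min d0 d1) => //; rewrite lt_min d00.
apply: ge_ereal_sup => _ [d /= + <-]; rewrite lt_min => /and3P[d_gt0 dd0 dd1].
have [|n [En nd]] := Hd d; first by rewrite d_gt0.
rewrite -EFinD ltW// box_ratio_lt ?d_gt0 ?(lt_trans dd1)//.
apply: le_lt_trans (covering_number_le En) _; rewrite lte_fin.
apply: (le_lt_trans nd).
have -> : - (s + e) = - (e / 2) + - (s + e / 2) by lra.
rewrite [ltRHS]powRD; last by rewrite (gt_eqF d_gt0) implybT.
by rewrite ltr_pM2r ?powR_gt0// Hd1// d_gt0.
Qed.

Lemma lower_box_dimP E s :
  (s%:E <= lower_box_dim dist E)%E <-> box_ge dist E s.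
Proof.
rewrite /lower_box_dim limf_einfE; split=> [H e e0|H].
  have sup_gt : ((s - e)%:E <
      ereal_sup [set ereal_inf (box_ratio dist E @` V) | V in 0^'+])%E.
    by apply: lt_le_trans H; rewrite lte_fin ltrBlDr ltrDl.
  have [_ [V /at_right0P[d0 d00 HV] <-] infV] := ereal_sup_gt sup_gt.
  exists 1, (Num.min d0 1); split=> //; first by rewrite lt_min d00 ltr01.
  move=> d n; rewrite lt_min andbA => /andP[dd0 d1] En.
  have d_gt0 : 0 < d by case/andP: dd0.
  have : ((s - e)%:E <= box_ratio dist E d)%E.
    apply: le_trans (ltW infV) _.
    by apply: ereal_inf_lbound; exists d => //; exact: HV.
  rewrite leNgt box_ratio_lt ?d_gt0// -leNgt mul1r => Hle.
  by rewrite -lee_fin; apply: le_trans Hle (covering_number_le En).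
apply/lee_subgt0Pr => e e0.
have e20 : 0 < e / 2 by rewrite divr_gt0.
have [c [d0 [c0 d00 Hd]]] := H _ e20.
have ci0 : 0 < c^-1 by rewrite invr_gt0.
have [d1 /andP[d10 d11] Hd1] := powR_dominates ci0 e20.
apply: (@le_trans _ _ (ereal_inf (box_ratio dist E @` [set d | 0 < d < Num.min d0 d1]))); last first.
  apply: ereal_sup_ubound; exists [set d | 0 < d < Num.min d0 d1] => //.
  by apply/at_right0P; exists (Num.min d0 d1) => //; rewrite lt_min d00.
apply: le_ereal_inf_tmp => _ [d /= + <-]; rewrite lt_min => /and3P[d_gt0 dd0 dd1].
rewrite -EFinB leNgt box_ratio_lt ?d_gt0 ?(lt_trans dd1)//.
apply/negP => /covering_number_lt[n [En]].
apply/negP; rewrite -leNgt; apply: le_trans (Hd d n _ En); last by rewrite d_gt0.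
have -> : - (s - e / 2) = - (e / 2) + - (s - e) by lra.
rewrite powRD; last by rewrite (gt_eqF d_gt0) implybT.
rewrite mulrA ler_peMl ?powR_ge0// -ler_pdivrMl// mulr1.
by rewrite ltW// Hd1// d_gt0.
Qed.

Lemma has_box_dimP E s :
  has_box_dim dist E s <-> box_le dist E s /\ box_ge dist E s.
Proof.
split=> [[Hl Hu]|[/upper_box_dimP Hu /lower_box_dimP Hl]].
  by split; [apply/upper_box_dimP; rewrite Hu|apply/lower_box_dimP; rewrite Hl].
have lu : (lower_box_dim dist E <= upper_box_dim dist E)%E by exact: limf_einf_le_esup.
split; apply/eqP; rewrite eq_le; apply/andP; split=> //.
  exact: le_trans lu Hu.
exact: le_trans Hl lu.
Qed.

Lemma box_dim_le_of E s u : box_ge dist E s -> box_le dist E u -> s <= u.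
Proof.
move=> /lower_box_dimP Hl /upper_box_dimP Hu; rewrite -lee_fin.
by apply: le_trans Hl _; apply: le_trans Hu; exact: limf_einf_le_esup.
Qed.

Lemma box_le_ge0 E s : E !=set0 -> box_le dist E s -> 0 <= s.
Proof.
move=> E0; apply: box_dim_le_of => e e0; exists 1, 1; split=> // d n /andP[d0 d1] En.
rewrite mul1r sub0r opprK (@le_trans _ _ 1)//.
  by rewrite -(powRr0 d); apply: ger_powR; rewrite ?d0 ltW.
by rewrite ler1n; exact: cover_by_gt0 En.
Qed.

(** The bound survives at all scales up to a given D: between d0 and D a single
    cover at scale d0 / 2 serves, and powers of d stay away from 0. *)
Lemma box_le_large E s e D : box_le dist E s -> 0 < e -> 0 < D ->
  exists2 C, 0 < C & forall d, 0 < d <= D ->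
    exists n, cover_by dist E d n /\ n%:R <= C * d `^ (- (s + e)).
Proof.
move=> Es e0 D0; have [C [d0 [C0 d00 HC]]] := Es _ e0.
have [|n0 [En0 _]] := HC (d0 / 2); first lra.
set t := - (s + e) in HC *; set m := Num.min (d0 `^ t) (D `^ t).
have m0 : 0 < m by rewrite lt_min !powR_gt0.
exists (C + n0%:R / m) => [|d /andP[d_gt0 dD]]; first by rewrite ltr_wpDr// divr_ge0// ltW.
have [dd0|d0d] := ltP d d0.
  have [|n [En nC]] := HC d; first by rewrite d_gt0.
  by exists n; split=> //; rewrite (le_trans nC)// ler_pM2r ?powR_gt0// lerDl divr_ge0// ltW.
exists n0; split; first by apply: cover_by_mon En0; lra.
have d0dD : d0 <= d <= D by rewrite d0d.
have /andP[mt _] := powR_between t d00 d0dD.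
apply: (@le_trans _ _ (n0%:R / m * d `^ t)).
  by rewrite mulrAC ler_pdivlMr// ler_wpM2l.
by rewrite ler_pM2r ?powR_gt0// lerDr ltW.
Qed.

(** Between d0 and D any cover of a nonempty set has at least one piece, and
    powers of d are bounded. *)
Lemma box_ge_large E s e D : E !=set0 -> box_ge dist E s -> 0 < e -> 0 < D ->
  exists2 c, 0 < c & forall d n, 0 < d <= D -> cover_by dist E d n ->
    c * d `^ (- (s - e)) <= n%:R.
Proof.
move=> E0 Es e0 D0; have [c [d0 [c0 d00 Hc]]] := Es _ e0.
set t := - (s - e) in Hc *; set m := Num.max (d0 `^ t) (D `^ t).
have m0 : 0 < m by rewrite lt_max powR_gt0.
exists (Num.min c m^-1) => [|d n /andP[d_gt0 dD] En]; first by rewrite lt_min c0 invr_gt0.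
have [dd0|d0d] := ltP d d0.
  apply: le_trans (Hc d n _ En); last by rewrite d_gt0.
  by rewrite ler_pM2r ?powR_gt0// ge_min lexx.
have d0dD : d0 <= d <= D by rewrite d0d.
have /andP[_ mt] := powR_between t d00 d0dD.
apply: (@le_trans _ _ 1); last by rewrite ler1n; exact: cover_by_gt0 En.
apply: (@le_trans _ _ (m^-1 * d `^ t)).
  by rewrite ler_pM2r ?powR_gt0// ge_min lexx orbT.
by rewrite ler_pdivrMl// mulr1.
Qed.

End BoxDimension.

(** A map that turns covers of E at scale d into covers of E' at scale K * d with
    as many pieces (a Lipschitz surjection, for instance) does not increase
    dimensions. *)
Section Transfer.
Variables (R : realType) (T T' : Type).
Variables (dist : T -> T -> R) (dist' : T' -> T' -> R).
Variables (E : set T) (E' : set T') (K : R).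
Hypothesis K_gt0 : 0 < K.
Hypothesis coverK : forall d n, 0 < d ->
  cover_by dist E d n -> cover_by dist' E' (K * d) n.

Lemma box_le_transfer s : box_le dist E s -> box_le dist' E' s.
Proof.
move=> H e e0; have [C [d0 [C0 d00 Hd]]] := H _ e0.
exists (C * K^-1 `^ (- (s + e))), (K * d0); split.
- by rewrite mulr_gt0 ?powR_gt0 ?invr_gt0.
- by rewrite mulr_gt0.
move=> d /andP[d_gt0 dK].
have [|n [En nd]] := Hd (K^-1 * d).
  by rewrite mulr_gt0 ?invr_gt0//= ltr_pdivrMl.
exists n; split.
  by rewrite -[d](mulVKf (lt0r_neq0 K_gt0)); apply: coverK => //; rewrite mulr_gt0 ?invr_gt0.
by rewrite -mulrA -powRM ?invr_ge0 ?(ltW K_gt0) ?(ltW d_gt0).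
Qed.

Lemma box_ge_transfer s : box_ge dist' E' s -> box_ge dist E s.
Proof.
move=> H e e0; have [c [d0 [c0 d00 Hd]]] := H _ e0.
exists (c * K `^ (- (s - e))), (K^-1 * d0); split.
- by rewrite mulr_gt0 ?powR_gt0.
- by rewrite mulr_gt0 ?invr_gt0.
move=> d n /andP[d_gt0 dK] En.
rewrite -mulrA -powRM ?(ltW K_gt0) ?(ltW d_gt0)//; apply: Hd; last exact: coverK.
by rewrite mulr_gt0//= mulrC -ltr_pdivlMr// mulrC.
Qed.

End Transfer.

(** * Packing dimension *)

Lemma pos_lower_bound (R : realType) (J : eqType) (s : seq J) (r : J -> R) :
  (forall k, k \in s -> 0 < r k) -> exists2 r0, 0 < r0 & forall k, k \in s -> r0 <= r k.
Proof.
elim: s => [|j s IH] H; first by exists 1.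
have [k ks|r0 r00 r0r] := IH; first by apply: H; rewrite inE ks orbT.
exists (Num.min r0 (r j)); first by rewrite lt_min r00 H ?mem_head.
move=> k; rewrite inE => /predU1P[->|ks]; first by rewrite ge_min lexx orbT.
by rewrite ge_min r0r.
Qed.

Lemma exists_exp_lt (R : realType) (q d r : R) :
  0 <= q < 1 -> 0 < r -> exists m, d * q ^+ m < r.
Proof.
move=> /andP[q0 q1] r0.
have : geometric d q @ \oo --> (0 : R^o).
  by apply: cvg_geometric; rewrite ger0_norm.
move=> /cvgrPdist_lt /(_ _ r0) [m _ /(_ m (leqnn m))].
by rewrite /= sub0r normrN => /(le_lt_trans (ler_norm _)) ?; exists m.
Qed.

Section PackingDimension.
Variables (R : realType) (T : Type) (dist : T -> T -> R).
Hypothesis dist0 : forall x, dist x x = 0.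
Hypothesis distC : forall x y, dist x y = dist y x.
Hypothesis distD : forall x y z, dist x z <= dist x y + dist y z.
Implicit Types (E : set T) (s u d : R).

(** The closure for [dist], expressed without a topology on T. *)
Definition adherence E : set T := [set y | forall e, 0 < e -> exists2 x, E x & dist x y <= e].

Lemma sub_adherence E : E `<=` adherence E.
Proof. by move=> x Ex e e0; exists x => //; rewrite dist0 ltW. Qed.

Lemma cover_by_adherence E d n :
  0 < d -> cover_by dist E d n -> cover_by dist (adherence E) (3 * d) n.
Proof.
move=> d0 [U [Ud EU]]; exists (fun k => [set y | exists2 x, U k x & dist x y <= d]); split.
  move=> k y1 y2 [x1 U1 xy1] [x2 U2 xy2].
  have := Ud k _ _ U1 U2; have := distD y1 x1 y2; have := distD x1 x2 y2.
  by rewrite (distC y1 x1); lra.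
by move=> y /(_ _ d0)[x /EU[k _ Ux] xy]; exists k => //; exists x.
Qed.

(** A set of diameter at most d contains at most one point of the family. *)
Lemma separated_le_cover (J : eqType) (r : seq J) (x : J -> T) E d n :
  uniq r -> (forall k, k \in r -> E (x k)) ->
  (forall k l, k \in r -> l \in r -> k != l -> d < dist (x k) (x l)) ->
  cover_by dist E d n -> (size r <= n)%N.
Proof.
move=> ur rE sep [U [Ud EU]].
have /choice[f fP] k : exists j : nat, k \in r ->
    (j < n)%N /\ (forall i : 'I_n, i = j :> nat -> U i (x k)).
  have [kr|] := boolP (k \in r); last by exists 0%N.
  have [i _ Ui] := EU _ (rE _ kr); exists i => _; split=> // i' /ord_inj ->.
  exact: Ui.
rewrite -(size_iota 0 n) -(size_map f r); apply: uniq_leq_size.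
  rewrite map_inj_in_uniq// => k l kr lr fkl; apply/eqP; apply: contraT => kl.
  have [fn Uk] := fP _ kr; have [_ Ul] := fP _ lr.
  have := Ud (Ordinal fn) _ _ (Uk (Ordinal fn) erefl) (Ul (Ordinal fn) fkl).
  by rewrite leNgt sep.
by move=> _ /mapP[k /fP[fkn _] ->]; rewrite mem_iota.
Qed.

(** Induction on the number m of dyadic ranges that the radii may occupy.  Balls
    with radii in ]rho / 2, rho] have centres more than rho / 2 apart, so there
    are at most C * (rho / 2)^(-v) of them; the others form an instance of
    the claim at rho / 2.  The constant is the sum of the geometric series of
    ratio 2^(-(u - v)) that results. *)
Lemma dyadic_packing_sum (E : set T) (u v C d0 : R) (x : nat -> T) (r : nat -> R) :
  0 <= u -> v < u -> 0 < C ->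
  (forall d, 0 < d < d0 -> exists n, cover_by dist E d n /\ n%:R <= C * d `^ (- v)) ->
  forall (m : nat) (rho : R) (s : seq nat), 0 < rho < d0 -> uniq s ->
  (forall k, k \in s -> E (x k)) ->
  (forall k, k \in s -> rho * 2^-1 ^+ m < r k <= rho) ->
  (forall k l, k \in s -> l \in s -> k != l ->
     dist_cball dist (x k) (r k) `&` dist_cball dist (x l) (r l) = set0) ->
  \sum_(k <- s) r k `^ u <=
    C * 2 `^ v / (1 - 2 `^ (- (u - v))) * rho `^ (u - v).
Proof.
move=> u0 vu C0 HC.
set q := 2 `^ (- (u - v)).
have q0 : 0 < q by rewrite powR_gt0.
have q1 : q < 1.
  by rewrite /q -[ltRHS](powRr0 2); apply: powR_lt; lra.
set K := _ / _.
have K0 : 0 < K by rewrite divr_gt0 ?mulr_gt0 ?powR_gt0// subr_gt0.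
elim=> [|m IH] rho s /andP[rho0 rhod] us sE sr sep.
  case: s sr {us sE sep} => [|k s sr]; first by rewrite big_nil mulr_ge0 ?powR_ge0 ?ltW.
  have /andP[] := sr k (mem_head _ _).
  by rewrite expr0 mulr1 => /lt_le_trans/[apply]; rewrite ltxx.
rewrite (bigID (fun k => rho / 2 < r k))/= -!(big_filter s).
set s1 := [seq k <- s | _]; set s2 := [seq k <- s | _].
have h2 : 0 < rho / 2 < d0 by lra.
have sum2 : \sum_(k <- s2) r k `^ u <= K * (rho / 2) `^ (u - v).
  apply: IH => //; first exact: filter_uniq.
  - by move=> k; rewrite mem_filter => /andP[_ /sE].
  - move=> k; rewrite mem_filter -leNgt => /andP[-> /sr/andP[+ _]].
    by rewrite andbT exprS mulrA.
  - by move=> k l; rewrite !mem_filter => /andP[_ ks] /andP[_ ls]; exact: sep.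
have [n [En nC]] := HC _ h2.
have s1n : (size s1 <= n)%N.
  (* If the centres k and l were within rho / 2, the centre of l would be in
     both balls. *)
  apply: (@separated_le_cover _ s1 x E (rho / 2)) => //; first exact: filter_uniq.
    by move=> k; rewrite mem_filter => /andP[_ /sE].
  move=> k l; rewrite !mem_filter => /andP[rk ks] /andP[rl ls] kl.
  rewrite ltNge; apply/negP => dkl.
  have /seteqP[/(_ (x l)) + _] := sep _ _ ks ls kl; apply; split.
    by rewrite /dist_cball /= (le_trans dkl)// ltW.
  by rewrite /dist_cball /= dist0; lra.
have sum1 : \sum_(k <- s1) r k `^ u <= C * 2 `^ v * rho `^ (u - v).
  apply: (@le_trans _ _ (n%:R * rho `^ u)).
    apply: (@le_trans _ _ (\sum_(k <- s1) rho `^ u)).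
      rewrite !big_seq; apply: ler_sum => k; rewrite mem_filter => /andP[rk /sr/andP[_ rrho]].
      by apply: ge0_ler_powR; rewrite // ?nnegrE; lra.
    by rewrite big_const_seq count_predT iter_addr_0 -[leLHS]mulr_natl ler_pM2r ?powR_gt0// ler_nat.
  apply: le_trans (ler_wpM2r (powR_ge0 rho u) nC) _.
  rewrite powRM ?invr_ge0 ?(ltW rho0)// -!mulrA ler_pM2l//.
  have -> : 2^-1 `^ (- v) = 2 `^ v by rewrite -powR_inv1// -powRrM mulN1r opprK.
  rewrite mulrCA ler_pM2l ?powR_gt0// -powRD; last by rewrite (gt_eqF rho0) implybT.
  by rewrite addrC.
apply: le_trans (lerD sum1 sum2) _.
rewrite powRM ?invr_ge0 ?(ltW rho0)//.
have -> : 2^-1 `^ (u - v) = q by rewrite -powR_inv1// -powRrM mulN1r.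
have -> : C * 2 `^ v = K * (1 - q) by rewrite divfK// subr_eq0 gt_eqF.
by rewrite le_eqVlt; apply/orP; left; apply/eqP; ring.
Qed.

(** The point p makes T inhabited; an empty type has no packing at all, not even
    the empty one, as a packing carries a sequence of centres. *)
Lemma packing_delta_ge0 (p : T) u E d : (0 <= packing_delta dist u E d)%E.
Proof.
apply: ereal_sup_ubound; exists set0, (fun=> p), (fun=> 0).
by split=> //; rewrite ?esum_set0// => i j [].
Qed.

Lemma packing_delta_homo u E :
  {homo packing_delta dist u E : d d' / d <= d' >-> (d <= d')%E}.
Proof.
move=> d d' dd'; apply: ge_ereal_sup => _ [D [x [r [DE Dr tD ->]]]].
apply: ereal_sup_ubound; exists D, x, r; split=> // k /Dr /andP[-> /=].
by move=> /le_trans; exact.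
Qed.

Lemma packing_premeasureE u E : packing_premeasure dist u E =
  ereal_inf (packing_delta dist u E @` `]0, +oo[%classic).
Proof.
apply: cvg_lim; first exact: ereal_hausdorff.
apply: nondecreasing_at_right_cvge => // d d' _ _; exact: packing_delta_homo.
Qed.

Lemma packing_premeasure_ge0 (p : T) u E : (0 <= packing_premeasure dist u E)%E.
Proof.
rewrite packing_premeasureE; apply: le_ereal_inf_tmp => _ [d _ <-].
exact: packing_delta_ge0.
Qed.

(** [dyadic_packing_sum] bounds every packing sum with radii at most d by a
    multiple of d^(u - v), where v is halfway between s and u. *)
Lemma packing_premeasure_eq0 (p : T) u s E :
  box_le dist E s -> 0 <= u -> s < u -> packing_premeasure dist u E = 0.
Proof.
move=> Es u0 su; apply/eqP; rewrite eq_le packing_premeasure_ge0// andbT.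
have e0 : 0 < (u - s) / 2 by lra.
have [C [d0 [C0 d00 HC]]] := Es _ e0.
have vu : s + (u - s) / 2 < u by lra.
have /= bound := dyadic_packing_sum u0 vu C0 HC.
set v := s + (u - s) / 2 in vu bound.
set K := _ / _ in bound.
have K0 : 0 < K.
  rewrite divr_gt0 ?mulr_gt0 ?powR_gt0// subr_gt0.
  by rewrite -[ltRHS](powRr0 2); apply: powR_lt; lra.
apply/lee_addgt0Pr => e e_gt0; rewrite add0e.
have t0 : 0 < u - v by rewrite subr_gt0.
have [d1 /andP[d10 _] Hd1] := powR_dominates (divr_gt0 (mulr_gt0 (powR_gt0 u (ltr0Sn R 1)) K0) e_gt0) t0.
pose d := Num.min d0 d1 / 2.
have d_gt0 : 0 < d by rewrite divr_gt0// lt_min d00.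
have dd0 : 0 < d < d0 by rewrite d_gt0 /d; have := ge_min d0 d0 d1; lra.
have dd1 : 0 < d < d1 by rewrite d_gt0 /d; have := ge_min d1 d0 d1; lra.
rewrite packing_premeasureE; apply: (@le_trans _ _ (packing_delta dist u E d)).
  by apply: ereal_inf_lbound; exists d => //=; rewrite in_itv /= d_gt0.
apply: ge_ereal_sup => _ [D [x [r [DE Dr tD ->]]]].
apply: ge_ereal_sup => _ [A [finA AD] <-].
rewrite fsbig_finite//= sumEFin lee_fin.
set l := finmap.enum_fset _.
have inA k : k \in l -> D k.
  have -> : (k \in l) = (k \in A) := in_fset_set finA k.
  by rewrite inE => /AD.
have [|r0 r00 r0r] := pos_lower_bound (s := l) (r := r).
  by move=> k /inA /Dr /andP[].
have [m Hm] := @exists_exp_lt R 2^-1 d r0 ltac:(lra) r00.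
have sep k j : k \in l -> j \in l -> k != j ->
    dist_cball dist (x k) (r k) `&` dist_cball dist (x j) (r j) = set0.
  move=> /inA Dk /inA Dj /eqP kj; apply/seteqP; split=> // y yy.
  by case: kj; apply: tD => //; exists y.
have /= := bound x r m d l dd0 (finmap.fset_uniq _)
  (fun k kA => DE k (inA k kA)) _ sep.
have -> : \sum_(i <- l) (2 * r i) `^ u = 2 `^ u * \sum_(i <- l) r i `^ u.
  rewrite big_distrr /= !big_seq; apply: eq_bigr => k /inA /Dr /andP[rk _].
  by rewrite powRM// ltW.
move=> bnd; apply: (@le_trans _ _ (2 `^ u * (K * d `^ (u - v)))).
  rewrite ler_pM2l ?powR_gt0//; apply: bnd => k kA.
  by rewrite (lt_le_trans Hm (r0r _ kA))/=; have /andP[] := Dr _ (inA _ kA).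
have := Hd1 _ dd1; rewrite powRN -[X in _ < X]mul1r ltr_pdivlMr ?powR_gt0//.
rewrite mulrAC ltr_pdivrMr// mul1r -[X in X < _ -> _]mulrA.
exact: ltW.
Qed.

Lemma packing_dim_le (p : T) s E :
  box_le dist E s -> 0 <= s -> (packing_dim dist E <= s%:E)%E.
Proof.
move=> Es s0; apply/lee_addgt0Pr => e e0; rewrite -EFinD.
apply: ereal_inf_lbound; exists (s + e) => //; split; first by rewrite addr_ge0// ltW.
apply/eqP; rewrite eq_le; apply/andP; split.
  apply: ereal_inf_lbound; exists (fun=> E); first by move=> x Ex; exists 0%N.
  have pe : packing_premeasure dist (s + e) E = 0.
    by apply: (packing_premeasure_eq0 p Es); rewrite ?ltrDl// addr_ge0// ltW.
  by rewrite eseries0.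
apply: le_ereal_inf_tmp => _ [U _ <-].
by apply: nneseries_ge0 => k _ _; exact: packing_premeasure_ge0.
Qed.

(** Balls of radius d around points more than 2 * d apart form a packing. *)
Lemma packing_delta_finite_family u E d C (m : nat) (x : nat -> T) :
  0 < d -> (packing_delta dist u E d <= C%:E)%E ->
  (forall i, (i < m)%N -> E (x i)) ->
  (forall i j, (i < m)%N -> (j < m)%N -> i != j -> 2 * d < dist (x i) (x j)) ->
  m%:R * (2 * d) `^ u <= C.
Proof.
move=> d0 pC xE sep; rewrite -lee_fin; apply: le_trans pC.
apply: ereal_sup_ge; exists (\esum_(k in `I_m) ((2 * d) `^ u)%:E).
  exists `I_m, x, (fun=> d); split=> // [k _|i j im jm [y [yi yj]]].
    by rewrite d0 lexx.
  apply/eqP; apply: contraT => ij; have := sep _ _ im jm ij.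
  move: yi yj; rewrite /dist_cball /= => yi yj.
  by have := distD (x i) y (x j); rewrite (distC y); lra.
apply: esum_ge; exists `I_m; first by split=> //; exact: finite_II.
rewrite -fsbig_ord sumEFin lee_fin sumr_const card_ord mulr_natl.
exact: lexx.
Qed.

(** A maximal family of points of E more than d / 2 apart is bounded in size by
    [packing_delta_finite_family], and by maximality the balls of radius d / 2
    around it cover E. *)
Lemma box_le_of_packing_finite u E :
  (packing_premeasure dist u E < +oo)%E -> box_le dist E u.
Proof.
have [[p Ep]|] := pselect (E !=set0); last first.
  move=> E0 _ e e0; exists 1, 1; split=> // d _; exists 0%N; split.
    by apply: cover_by_sub (cover_by0 dist d) => x Ex; apply: E0; exists x.
  by rewrite mul1r powR_ge0.
rewrite packing_premeasureE => /ereal_inf_lt[_ [d0 /= + <-]].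
rewrite in_itv /= andbT => d00.
have := packing_delta_ge0 p u E d0.
case Epd: packing_delta => [C| |]// C0 _.
rewrite lee_fin in C0.
have pC d : 0 < d <= d0 -> (packing_delta dist u E d <= C%:E)%E.
  by move=> /andP[_ dd0]; rewrite -Epd; exact: packing_delta_homo.
move=> e e0; exists ((C + 1) * 2^-1 `^ (- u)), (Num.min (4 * d0) 1); split.
- by rewrite mulr_gt0 ?powR_gt0//; lra.
- by rewrite lt_min ltr01 andbT; lra.
move=> d; rewrite lt_min => /and3P[d_gt0 dd0 d1].
have rd : 0 < d / 4 <= d0 by lra.
have rd0 : 0 < d / 4 by lra.
pose P m := `[< exists x : nat -> T, (forall i, (i < m)%N -> E (x i)) /\
  forall i j, (i < m)%N -> (j < m)%N -> i != j -> 2 * (d / 4) < dist (x i) (x j) >].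
have bound m : P m -> m%:R * (2 * (d / 4)) `^ u <= C.
  by move=> /asboolP[x [xE sep]]; exact: packing_delta_finite_family (pC _ rd) xE sep.
have h0 : 0 < (2 * (d / 4)) `^ u by rewrite powR_gt0; lra.
have Pex : exists m, P m by exists 0%N; apply/asboolP; exists (fun=> p).
have Pub m : P m -> (m <= Num.Def.archi_bound (C / (2 * (d / 4)) `^ u))%N.
  move=> /bound; rewrite -ler_pdivlMr// => mC.
  by rewrite -(ler_nat R) (le_trans mC)// ltW// archi_boundP// divr_ge0// ltW.
case: (ex_maxnP Pex Pub) => m Pm mmax.
have mC := bound _ Pm; move/asboolP: Pm => [x [xE sep]].
exists m; split; last first.
  rewrite -ler_pdivlMr// in mC; apply: (le_trans mC).
  have -> : 2 * (d / 4) = 2^-1 * d by lra.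
  have -> : C / (2^-1 * d) `^ u = C * (2^-1 `^ (- u) * d `^ (- u)).
    by rewrite -powRN powRM// ltW.
  apply: (@le_trans _ _ ((C + 1) * (2^-1 `^ (- u) * d `^ (- u)))).
    by rewrite ler_pM2r ?mulr_gt0 ?powR_gt0// lerDl.
  rewrite mulrA ler_pM2l; last by rewrite mulr_gt0 ?powR_gt0//; lra.
  by apply: ger_powR; rewrite ?d_gt0 ?(ltW d1)//; lra.
exists (fun k : 'I_m => dist_cball dist (x k) (d / 2)); split.
  move=> k y z; rewrite /dist_cball /= => ky kz.
  by have := distD y (x k) z; rewrite (distC y (x k)); lra.
move=> y Ey; apply: contrapT => yfar.
have far i : (i < m)%N -> 2 * (d / 4) < dist (x i) y.
  move=> im; rewrite ltNge; apply/negP => iy; apply: yfar.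
  by exists (Ordinal im) => //; rewrite /dist_cball /=; lra.
have : P m.+1; last by move=> /mmax; rewrite ltnn.
apply/asboolP; exists (fun i => if (i < m)%N then x i else y); split.
  by move=> i _; case: ifPn => // im; exact: xE.
move=> i j; rewrite !ltnS => im jm ij.
case: ltnP => im'; case: ltnP => jm'.
- exact: sep.
- exact: far.
- by rewrite distC; exact: far.
- have ei : i = m by apply/eqP; rewrite eqn_leq im.
  have ej : j = m by apply/eqP; rewrite eqn_leq jm.
  by rewrite ei ej eqxx in ij.
Qed.

(** If the packing measure at exponent u vanishes, E is covered by sets of finite
    premeasure, whose upper box dimensions, and those of their closures, are at
    most u. *)
Lemma packing_dim_ge (p : T) s E :
  (forall (U : nat -> set T) u, E `<=` \bigcup_k adherence (U k) -> 0 <= u -> u < s ->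
     exists k, ~ box_le dist (adherence (U k)) u) ->
  (s%:E <= packing_dim dist E)%E.
Proof.
move=> H; apply: le_ereal_inf_tmp => _ [u [u0 pu] <-]; rewrite lee_fin leNgt.
apply/negP => us.
have : (packing_measure dist u E < 1)%E by rewrite pu lte01.
move=> /ereal_inf_lt[_ [U EU <-] Usum].
have [|k nb] := H U u _ u0 us.
  by move=> x /EU[k _ Ux]; exists k => //; exact: sub_adherence.
apply: nb; apply: (box_le_transfer (ltr0Sn R 2)).
  by move=> d n d0; exact: cover_by_adherence.
apply: box_le_of_packing_finite; rewrite ltey; apply/eqP => pk.
have := nneseries_pinfty (fun j _ => packing_premeasure_ge0 p u (U j))
  (erefl true : predT k) pk.
by move=> sumoo; rewrite sumoo in Usum.
Qed.

End PackingDimension.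

(** * The Euclidean plane *)

Section EuclideanPlane.
Variable R : realType.
Implicit Types p q r : 'cV[R]_2.

Lemma eucl_distE p q :
  eucl_dist p q = Num.sqrt ((p 0 0 - q 0 0) ^+ 2 + (p 1 0 - q 1 0) ^+ 2).
Proof.
by rewrite /eucl_dist /eucl_norm big_ord_recl big_ord1 !mxE (_ : lift _ _ = 1)//; apply: val_inj.
Qed.

Lemma eucl_dist0 p : eucl_dist p p = 0.
Proof. by rewrite eucl_distE !subrr expr0n addr0 sqrtr0. Qed.

Lemma eucl_distC p q : eucl_dist p q = eucl_dist q p.
Proof. by rewrite !eucl_distE -(sqrrN (p 0 0 - _)) -(sqrrN (p 1 0 - _)) !opprB. Qed.

(** Cauchy-Schwarz, as (a * d - b * c)^2 >= 0. *)
Lemma sqrt_triangle (a b c d : R) :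
  Num.sqrt ((a + c) ^+ 2 + (b + d) ^+ 2) <=
  Num.sqrt (a ^+ 2 + b ^+ 2) + Num.sqrt (c ^+ 2 + d ^+ 2).
Proof.
set A := _ + b ^+ 2; set C := c ^+ 2 + _.
have A0 : 0 <= A by rewrite addr_ge0 ?sqr_ge0.
have C0 : 0 <= C by rewrite addr_ge0 ?sqr_ge0.
rewrite -(ler_pXn2r (n := 2)) ?nnegrE ?addr_ge0 ?sqrtr_ge0//.
rewrite sqr_sqrtr ?addr_ge0 ?sqr_ge0// [leRHS]sqrrD !sqr_sqrtr// -sqrtrM//.
have : a * c + b * d <= Num.sqrt (A * C).
  apply: le_trans (ler_norm _) _; rewrite -sqrtr_sqr ler_sqrt ?mulr_ge0//.
  by rewrite -subr_ge0 (_ : _ - _ = (a * d - b * c) ^+ 2) ?sqr_ge0// /A /C; ring.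
by rewrite /A /C; lra.
Qed.

Lemma eucl_distD p q r : eucl_dist p r <= eucl_dist p q + eucl_dist q r.
Proof.
rewrite !eucl_distE; apply: le_trans (sqrt_triangle _ _ _ _).
by rewrite !addrA !subrK.
Qed.

Lemma dist_x_le p q : `|p 0 0 - q 0 0| <= eucl_dist p q.
Proof. by rewrite eucl_distE -sqrtr_sqr ler_sqrt ?lerDl ?addr_ge0 ?sqr_ge0. Qed.

Lemma dist_y_le p q : `|p 1 0 - q 1 0| <= eucl_dist p q.
Proof. by rewrite eucl_distE -sqrtr_sqr ler_sqrt ?lerDr ?addr_ge0 ?sqr_ge0. Qed.

Lemma dist_le_xy p q : eucl_dist p q <= `|p 0 0 - q 0 0| + `|p 1 0 - q 1 0|.
Proof.
rewrite eucl_distE -[leRHS]ger0_norm ?addr_ge0// -sqrtr_sqr ler_sqrt ?sqr_ge0//.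
by rewrite [leRHS]sqrrD !real_normK ?num_real// lerD2r lerDl mulrn_wge0// mulr_ge0.
Qed.

Definition vec2 (x y : R) : 'cV[R]_2 := \col_i (if i == 0 then x else y).

Lemma vec2_x x y : vec2 x y 0 0 = x. Proof. by rewrite mxE. Qed.
Lemma vec2_y x y : vec2 x y 1 0 = y. Proof. by rewrite mxE. Qed.

Lemma cV2P p q : p 0 0 = q 0 0 -> p 1 0 = q 1 0 -> p = q.
Proof.
move=> e0 e1; apply/matrixP => i j; rewrite !ord1.
have [->|->//] : i = 0 \/ i = 1 by case: i => [[|[|//]]] ?; [left|right]; apply: val_inj.
by [].
Qed.

End EuclideanPlane.

Section Interval.
Variable R : realType.

Lemma affine_interval (alpha c x1 x2 : R) : alpha != 0 -> x1 < x2 ->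
  exists y1 y2, [/\ y2 - y1 = `|alpha| * (x2 - x1),
    forall x, x1 <= x <= x2 -> y1 <= alpha * x + c <= y2 &
    forall y, y1 < y < y2 -> exists2 x, x1 < x < x2 & y = alpha * x + c].
Proof.
move=> a0 x12; have inv y : alpha * ((y - c) / alpha) + c = y.
  by rewrite mulrC divfK// subrK.
have [ap|an|/eqP] := ltgtP 0 alpha; last by rewrite eq_sym (negbTE a0).
- exists (alpha * x1 + c), (alpha * x2 + c); split.
  + by rewrite gtr0_norm//; ring.
  + by move=> x /andP[h1 h2]; rewrite !lerD2r !ler_pM2l// h1.
  + move=> y /andP[h1 h2]; exists ((y - c) / alpha); last by rewrite inv.
    by rewrite ltr_pdivlMr// ltr_pdivrMr// ![_ * alpha]mulrC; apply/andP; split; lra.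
- exists (alpha * x2 + c), (alpha * x1 + c); split.
  + by rewrite ltr0_norm//; ring.
  + by move=> x /andP[h1 h2]; rewrite !lerD2r !ler_nM2l// h1 andbT.
  + move=> y /andP[h1 h2]; exists ((y - c) / alpha); last by rewrite inv.
    by rewrite ltr_ndivlMr// ltr_ndivrMr// ![_ * alpha]mulrC; apply/andP; split; lra.
Qed.

(** The interval ]y1, y2[ is longer than 4 * h, so it extends 2 * h to the left
    or to the right of its point m; going from m in that direction one meets a
    point of the grid of mesh h centred at q within 2 * h. *)
Lemma grid_point (y1 y2 m q d h : R) (M : nat) : 0 < h -> 4 * h < y2 - y1 ->
  y1 <= m <= y2 -> `|m - q| <= d -> d / h + 2 <= M%:R ->
  exists j : 'I_(2 * M), y1 < q + h * (j%:R - M%:R) < y2.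
Proof.
move=> h0 y12 /andP[my1 my2] mq dM.
(* The abscissa of m on the grid, shifted by M to be positive. *)
set t := (m - q) / h + M%:R.
have mh : `|(m - q) / h| <= d / h.
  by rewrite normrM (gtr0_norm (x := h^-1)) ?invr_gt0// ler_pM2r ?invr_gt0.
have t0 : 2 <= t by rewrite /t; move: mh; rewrite ler_norml => /andP[]; lra.
have t1 : t + 2 <= (2 * M)%:R.
  by rewrite /t natrM; move: mh; rewrite ler_norml => /andP[]; lra.
have mE : m = q + h * (t - M%:R) by rewrite /t addrK mulrC divfK ?gt_eqF//; ring.
have /andP[tn tn1] : (Num.truncn t)%:R <= t < (Num.truncn t).+1%:R.
  by apply: truncn_itv; lra.
set n := Num.truncn t in tn tn1 *.
rewrite -natr1 in tn1.
have [my|my] := ltP (m + 2 * h) y2.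
  have jP : (n.+1 < 2 * M)%N by rewrite -(ltr_nat R) -natr1; lra.
  exists (Ordinal jP) => /=; rewrite -natr1.
  apply/andP; split; first by rewrite (le_lt_trans my1)// mE ltrD2l ltr_pM2l//; lra.
  apply: le_lt_trans my; rewrite mE.
  have : h * (n%:R + 1 - M%:R) <= h * (t - M%:R + 2) by rewrite ler_pM2l//; lra.
  by lra.
have n1 : (1 <= n)%N by rewrite -(ler_nat R); lra.
have jP : (n.-1 < 2 * M)%N by rewrite -(ltr_nat R) -subn1 natrB//; lra.
exists (Ordinal jP) => /=; rewrite -subn1 natrB//.
apply/andP; split; last first.
  by apply: lt_le_trans my2; rewrite mE ltrD2l ltr_pM2l//; lra.
apply: (@lt_trans _ _ (m - 2 * h)); first lra.
rewrite mE.
have : h * (t - M%:R - 2) < h * (n%:R - 1 - M%:R) by rewrite ltr_pM2l//; lra.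
by lra.
Qed.

End Interval.

(** * Words, cuts and cylinders *)

Section CutSet.
Variables (R : realType) (I : finType) (b : I -> R).
Hypothesis b_gt0 : forall i, 0 < b i.

(** The words along which the product of b first drops to about d: each letter i
    divides d by b i, so the test for continuing is always against 1.  The
    recursion is on n, which bounds the lengths of the words and has to be large
    enough for [cut_le]. *)
Fixpoint cut (n : nat) (d : R) : seq (seq I) :=
  if n is m.+1 then
    if d < 1 then [seq i :: w | i <- enum I, w <- cut m (d / b i)] else [:: [::]]
  else [:: [::]].

Lemma cut_uniq n d : uniq (cut n d).
Proof.
elim: n d => [|n IH] d //=; case: ifP => // _.
by apply: allpairs_uniq_dep; rewrite ?enum_uniq// => [[i v] [j w] _ _ [-> ->]].
Qed.

(** Replacing a word by all its one-letter extensions preserves the sum. *)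
Lemma sum_cut (psi : I -> R) n d : \sum_i psi i = 1 ->
  \sum_(w <- cut n d) \prod_(i <- w) psi i = 1.
Proof.
move=> psi1; elim: n d => [|n IH] d /=; first by rewrite big_seq1 big_nil.
case: ifP => _; last by rewrite big_seq1 big_nil.
rewrite big_allpairs_dep /= -[RHS]psi1 big_enum /=; apply: eq_bigr => i _.
rewrite -[RHS]mulr1 -[X in _ = _ * X](IH (d / b i)) mulr_sumr.
by apply: eq_bigr => w _; rewrite big_cons.
Qed.

Lemma cut_le (beta : R) n d w : 0 < beta -> (forall i, b i <= beta) ->
  beta ^+ n <= d -> w \in cut n d -> \prod_(i <- w) b i <= d.
Proof.
move=> beta0 bb; elim: n d w => [|n IH] d w /=.
  by rewrite expr0 inE => d1 /eqP ->; rewrite big_nil.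
case: ltP => d1 Hd; last by rewrite inE => /eqP ->; rewrite big_nil.
move=> /allpairsPdep[i [v [_ vc ->]]]; rewrite big_cons.
rewrite mulrC -ler_pdivlMr//; apply: IH vc.
rewrite ler_pdivlMr// (le_trans _ Hd)// exprSr ler_pM2l ?exprn_gt0//.
Qed.

(** The last letter of a nonempty word was appended where the product exceeded d,
    and it contributes at least kappa; the empty word needs d <= kappa^-1. *)
Lemma cut_ge (kappa : R) n d w : 0 < kappa -> (forall i, kappa <= b i) ->
  d <= kappa^-1 -> w \in cut n d -> kappa * d <= \prod_(i <- w) b i.
Proof.
move=> k0 bk; elim: n d w => [|n IH] d w /=.
  by rewrite inE => Hd /eqP ->; rewrite big_nil -ler_pdivlMl// mulr1.
case: ltP => d1 Hd; last by rewrite inE => /eqP ->; rewrite big_nil -ler_pdivlMl// mulr1.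
move=> /allpairsPdep[i [v [_ vc ->]]]; rewrite big_cons.
rewrite [leRHS]mulrC -ler_pdivrMr// -mulrA; apply: IH vc.
rewrite ler_pdivrMr// (le_trans (ltW d1))// -ler_pdivrMl ?invr_gt0// invrK mulr1.
exact: bk.
Qed.

End CutSet.

(** The maps are abstract: only their action on each coordinate matters. *)
Section IFS.
Variables (R : realType) (I : finType).
Variables (alpha beta : I -> R) (t : I -> 'cV[R]_2) (S : I -> 'cV[R]_2 -> 'cV[R]_2).
Hypothesis S_x : forall i p, S i p 0 0 = alpha i * p 0 0 + t i 0 0.
Hypothesis S_y : forall i p, S i p 1 0 = beta i * p 1 0 + t i 1 0.
Hypothesis beta_neq0 : forall i, beta i != 0.
Hypothesis beta_le : forall i, `|beta i| <= `|alpha i|.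
Variable lambda : R.
Hypothesis lambda_lt1 : 0 < lambda < 1.
Hypothesis alpha_le : forall i, `|alpha i| <= lambda.

Definition Sw (w : seq I) : 'cV[R]_2 -> 'cV[R]_2 := foldr (fun i f => S i \o f) id w.

Definition width (w : seq I) : R := \prod_(i <- w) `|alpha i|.
Definition height (w : seq I) : R := \prod_(i <- w) `|beta i|.

Lemma beta_gt0 i : 0 < `|beta i|. Proof. by rewrite normr_gt0. Qed.
Lemma alpha_gt0 i : 0 < `|alpha i|. Proof. exact: lt_le_trans (beta_gt0 i) (beta_le i). Qed.

Lemma alpha_lt1 i : `|alpha i| < 1.
Proof. by have /andP[_] := lambda_lt1; exact: le_lt_trans (alpha_le i). Qed.

Lemma width_gt0 w : 0 < width w.
Proof. by apply: prodr_gt0 => i _; exact: alpha_gt0. Qed.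
Lemma height_gt0 w : 0 < height w.
Proof. by apply: prodr_gt0 => i _; exact: beta_gt0. Qed.
Lemma height_le_width w : height w <= width w.
Proof. by apply: ler_prod => i _; rewrite beta_le ltW// beta_gt0. Qed.
Lemma width_le1 w : width w <= 1.
Proof.
rewrite -[leRHS](big1_eq (op := *%R) w xpredT); apply: ler_prod => i _.
by apply/andP; split; apply/ltW; [exact: alpha_gt0|exact: alpha_lt1].
Qed.

Lemma Sw_x w p : Sw w p 0 0 = (\prod_(i <- w) alpha i) * p 0 0 + Sw w 0 0 0.
Proof.
elim: w => [|i w IH] /=; first by rewrite big_nil mul1r mxE addr0.
by rewrite !S_x IH big_cons mulrDr mulrA addrA.
Qed.

Lemma Sw_y w p : Sw w p 1 0 = (\prod_(i <- w) beta i) * p 1 0 + Sw w 0 1 0.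
Proof.
elim: w => [|i w IH] /=; first by rewrite big_nil mul1r mxE addr0.
by rewrite !S_y IH big_cons mulrDr mulrA addrA.
Qed.

Lemma Sw_dist_x w p q : `|Sw w p 0 0 - Sw w q 0 0| = width w * `|p 0 0 - q 0 0|.
Proof. by rewrite (Sw_x w p) (Sw_x w q) opprD addrACA subrr addr0 -mulrBr normrM normr_prod. Qed.

Lemma Sw_dist_y w p q : `|Sw w p 1 0 - Sw w q 1 0| = height w * `|p 1 0 - q 1 0|.
Proof. by rewrite (Sw_y w p) (Sw_y w q) opprD addrACA subrr addr0 -mulrBr normrM normr_prod. Qed.

Lemma Sw_dist_ge w p q : height w * eucl_dist p q <= eucl_dist (Sw w p) (Sw w q).
Proof.
have h0 := height_gt0 w.
have hx : (Sw w p 0 0 - Sw w q 0 0) ^+ 2 = width w ^+ 2 * (p 0 0 - q 0 0) ^+ 2.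
  by rewrite -(real_normK (num_real (Sw _ _ _ _ - _))) Sw_dist_x exprMn real_normK// num_real.
have hy : (Sw w p 1 0 - Sw w q 1 0) ^+ 2 = height w ^+ 2 * (p 1 0 - q 1 0) ^+ 2.
  by rewrite -(real_normK (num_real (Sw _ _ _ _ - _))) Sw_dist_y exprMn real_normK// num_real.
rewrite !eucl_distE hx hy -[X in X * _](ger0_norm (ltW h0)) -sqrtr_sqr -sqrtrM ?sqr_ge0//.
rewrite ler_sqrt; last by apply: addr_ge0; apply: mulr_ge0; exact: sqr_ge0.
rewrite mulrDr lerD2r.
apply: ler_wpM2r; first exact: sqr_ge0.
by rewrite ler_sqr ?nnegrE ?height_le_width// ltW// width_gt0.
Qed.

Lemma Sw_cat v w p : Sw (v ++ w) p = Sw v (Sw w p).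
Proof. by elim: v => //= i v ->. Qed.

Lemma S_inj i : injective (S i).
Proof.
move=> p q; rewrite -[S i p]/(Sw [:: i] p) -[S i q]/(Sw [:: i] q) => e.
have /eqP hx := Sw_dist_x [:: i] p q; have /eqP hy := Sw_dist_y [:: i] p q.
rewrite e !subrr normr0 eq_sym mulf_eq0 gt_eqF ?width_gt0//= in hx.
rewrite e !subrr normr0 eq_sym mulf_eq0 gt_eqF ?height_gt0//= in hy.
by apply: cV2P; apply/eqP; rewrite -subr_eq0 -normr_eq0.
Qed.

Local Notation cuts := (cut (fun i => `|beta i|)).

Variable F : set 'cV[R]_2.
Hypothesis F_eq : F = \bigcup_i (S i @` F).
Variable H : R.
Hypothesis F_x_bounded : forall p q, F p -> F q -> `|p 0 0 - q 0 0| <= H.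
Hypothesis F_y_bounded : forall p q, F p -> F q -> `|p 1 0 - q 1 0| <= H.

Lemma F_preimage p : F p -> exists i q, F q /\ p = S i q.
Proof. by rewrite {1}F_eq => -[i _ [q Fq <-]]; exists i, q. Qed.

Lemma Sw_stable w q : F q -> F (Sw w q).
Proof. by elim: w => //= i w IH /IH Fw; rewrite F_eq; exists i => //; exists (Sw w q). Qed.

Lemma word_cover n p : F p -> exists w q, [/\ size w = n, F q & p = Sw w q].
Proof.
elim: n p => [|n IH] p Fp; first by exists [::], p.
have [i [q [Fq ->]]] := F_preimage Fp.
by have [w [r [sw Fr ->]]] := IH _ Fq; exists (i :: w), r; rewrite /= sw.
Qed.

Lemma cut_cover n d p : F p ->
  exists2 w, w \in cuts n d & exists2 q, F q & p = Sw w q.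
Proof.
elim: n d p => [|n IH] d p Fp /=; first by exists [::]; [rewrite inE|exists p].
case: ifP => _; last by exists [::]; [rewrite inE|exists p].
have [i [q [Fq ->]]] := F_preimage Fp.
have [w wc [r Fr ->]] := IH (d / `|beta i|) _ Fq; exists (i :: w); last by exists r.
by apply/allpairsPdep; exists i, w; rewrite mem_enum.
Qed.

Lemma width_le w : width w <= lambda ^+ size w.
Proof.
have /andP[l0 _] := lambda_lt1.
elim: w => [|i w IH]; first by rewrite /width big_nil.
by rewrite /width big_cons exprS ler_pM// ltW// ?alpha_gt0// width_gt0.
Qed.

(** * Counting covers along a cut *)

Lemma cover_by_proj d n :
  cover_by (@eucl_dist R 2) F d n -> cover_by (@real_dist R) (proj1_set F) d n.
Proof.
move=> [U [Ud FU]]; exists (fun k => [set x | exists2 p, U k p & x = p 0 0]); split.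
  by move=> k _ _ [p Up ->] [q Uq ->]; apply: le_trans (dist_x_le p q) (Ud _ _ _ Up Uq).
by move=> _ [p /FU[k _ Ukp] <-]; exists k => //; exists p.
Qed.

Lemma cover_by_cylinder w d n : cover_by (@eucl_dist R 2) (Sw w @` F) d n ->
  cover_by (@eucl_dist R 2) F (d / height w) n.
Proof.
move=> [U [Ud FU]]; exists (fun k => [set p | U k (Sw w p)]); split.
  move=> k p q /= Up Uq; rewrite ler_pdivlMr ?height_gt0// mulrC.
  exact: le_trans (Sw_dist_ge _ _ _) (Ud _ _ _ Up Uq).
by move=> p Fp; have [|k _ Uk] := FU (Sw w p); [exists p|exists k].
Qed.

(** A cover of pi_1(F) at scale d / width w lifts to a cover of the cylinder of w
    by sets of width d, and their height is at most H * height w <= H * d. *)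
Lemma cover_F_upper n d (k : seq I -> nat) : 0 < d -> lambda ^+ n <= d ->
  (forall w, w \in cuts n d ->
     cover_by (@real_dist R) (proj1_set F) (d / width w) (k w)) ->
  cover_by (@eucl_dist R 2) F ((1 + H) * d)
    (\sum_(w <- cuts n d) k w).
Proof.
move=> d0 ld Hk; have /andP[l0 l1] := lambda_lt1.
pose E (w : seq I) : set 'cV[R]_2 := Sw w @` F.
apply: (@cover_by_sub _ _ _ [set p | exists2 w, w \in cuts n d & E w p]).
  move=> p Fp; have [w wc [q Fq ->]] := cut_cover n d Fp.
  by exists w => //; exists q.
apply: cover_by_bigcup => w wc; have [V [Vd FV]] := Hk w wc.
exists (fun j => [set p | exists q, [/\ F q, V j (q 0 0) & p = Sw w q]]); split.
  move=> j _ _ [p [Fp Vp ->]] [q [Fq Vq ->]].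
  apply: le_trans (dist_le_xy _ _) _; rewrite mulrDl mul1r Sw_dist_x Sw_dist_y.
  apply: lerD.
    have := Vd j _ _ Vp Vq; rewrite /real_dist ler_pdivlMr ?width_gt0//.
    by rewrite mulrC.
  rewrite mulrC ler_pM//; [exact: ltW (height_gt0 w)|exact: F_y_bounded|].
  have := cut_le (b := fun i => `|beta i|) beta_gt0 l0 _ ld wc; apply.
  by move=> i; exact: le_trans (beta_le i) (alpha_le i).
move=> _ [q Fq <-]; have [|j _ Vj] := FV (q 0 0); first by exists q.
by exists j => //; exists q.
Qed.

Section OpenRectangle.
Variables (x1 x2 y1 y2 : R).
Let U := open_rect x1 x2 y1 y2.
Hypothesis x12 : x1 < x2.
Hypothesis y12 : y1 < y2.
Hypothesis S_U : forall i, S i @` U `<=` U.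
Hypothesis S_disj : trivIset [set: I] (fun i => S i @` U).

Lemma Sw_U w p : U p -> U (Sw w p).
Proof. by move=> Up; elim: w => //= i w IH; apply: (S_U (i := i)); exists (Sw w p). Qed.

(** Two distinct words of a cut disagree at some letter, where the images of U
    separate. *)
Lemma cut_disjoint n d w w' p p' : w \in cuts n d -> w' \in cuts n d ->
  U p -> U p' -> Sw w p = Sw w' p' -> w = w'.
Proof.
elim: n d w w' => [|n IH] d w w' /=; first by rewrite !inE => /eqP -> /eqP ->.
case: ifP => _; last by rewrite !inE => /eqP -> /eqP ->.
move=> /allpairsPdep[i [v [_ vc ->]]] /allpairsPdep[j [v' [_ vc' ->]]] Up Up' /= e.
have ij : i = j.
  apply: (S_disj (i := i) (j := j)) => //; exists (S i (Sw v p)); split.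
    by exists (Sw v p) => //; exact: Sw_U.
  by rewrite e; exists (Sw v' p') => //; exact: Sw_U.
by subst j; congr cons; apply: (IH (d / `|beta i|)) => //; exact: S_inj e.
Qed.

(** A point of F lies in cylinders of arbitrarily long words w, and S_w maps a
    point of U close to it. *)
Lemma F_near_U p e : F p -> 0 < e ->
  exists2 r, U r & `|p 0 0 - r 0 0| <= e /\ `|p 1 0 - r 1 0| <= e.
Proof.
move=> Fp e0.
pose r0 := vec2 ((x1 + x2) / 2) ((y1 + y2) / 2).
have Ur0 : U r0.
  have := x12; have := y12; rewrite /U /open_rect /= vec2_x vec2_y.
  by split; apply/andP; split; lra.
pose D := H + `|p 0 0 - r0 0 0| + `|p 1 0 - r0 1 0|.
have H0 : 0 <= H by apply: le_trans (F_x_bounded Fp Fp).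
have l01 : 0 <= lambda < 1 by have := lambda_lt1; lra.
have [m Hm] := exists_exp_lt D l01 e0.
have [w [q [sw Fq pE]]] := word_cover m Fp.
have wl : width w <= lambda ^+ m by rewrite -sw width_le.
have D0 : 0 <= D by rewrite !addr_ge0.
exists (Sw w r0); first exact: Sw_U.
rewrite {1 2}pE Sw_dist_x Sw_dist_y; split.
  apply: le_trans (ltW Hm); rewrite mulrC ler_pM//; first exact/ltW/width_gt0.
  apply: le_trans (ler_distD (p 0 0) _ _) _.
  have := F_x_bounded Fq Fp; have := normr_ge0 (p 1 0 - r0 1 0).
  by rewrite /D; lra.
apply: le_trans (ltW Hm); rewrite mulrC ler_pM//; first exact/ltW/height_gt0.
  apply: le_trans (ler_distD (p 1 0) _ _) _.
  have := F_y_bounded Fq Fp; have := normr_ge0 (p 0 0 - r0 0 0).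
  by rewrite /D; lra.
exact: le_trans (height_le_width w) wl.
Qed.

Lemma F_closed_rect p : F p -> closed_rect x1 x2 y1 y2 p.
Proof.
move=> Fp; have near e (e0 : 0 < e) := F_near_U Fp e0.
split; apply/andP; split; rewrite leNgt; apply/negP => lt0.
- have [r [/andP[a _] _] [b _]] := near ((x1 - p 0 0) / 2) ltac:(by rewrite divr_gt0// subr_gt0).
  by move: b; rewrite ler_norml => /andP[]; lra.
- have [r [/andP[_ a] _] [b _]] := near ((p 0 0 - x2) / 2) ltac:(by rewrite divr_gt0// subr_gt0).
  by move: b; rewrite ler_norml => /andP[]; lra.
- have [r [_ /andP[a _]] [_ b]] := near ((y1 - p 1 0) / 2) ltac:(by rewrite divr_gt0// subr_gt0).
  by move: b; rewrite ler_norml => /andP[]; lra.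
- have [r [_ /andP[_ a]] [_ b]] := near ((p 1 0 - y2) / 2) ltac:(by rewrite divr_gt0// subr_gt0).
  by move: b; rewrite ler_norml => /andP[]; lra.
Qed.

(** The cylinder of w lies in the closure of the cell S_w(U), by
    [F_closed_rect], so the cell comes close to V when the cylinder meets V.  The
    sides of the cell exceed 4 * h with h = kappa * omega * d / 5, where omega is
    the smaller side of U.  By [grid_point] the cell contains a point of the grid
    of mesh h around a point z of V; distinct words have disjoint cells, hence
    distinct grid points.  As d / h does not depend on d, neither does the
    number of grid points that may occur. *)
Lemma count_cells (kappa : R) : 0 < kappa ->
  exists C : nat, forall d n (V : set 'cV[R]_2), 0 < d ->
    (forall w, w \in cuts n d -> kappa * d <= height w) ->
    diam_le (@eucl_dist R 2) V d ->
    (count (fun w => `[< exists2 q, F q & V (Sw w q) >]) (cuts n d) <= C)%N.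
Proof.
move=> k0; pose omega := Num.min (x2 - x1) (y2 - y1).
have o0 : 0 < omega by rewrite lt_min !subr_gt0 x12.
have ko0 : 0 < kappa * omega by rewrite mulr_gt0.
have [M MP] : exists M : nat, 5 / (kappa * omega) + 2 <= M%:R :> R.
  eexists; apply/ltW/archi_boundP; rewrite addr_ge0// divr_ge0//; exact: ltW.
exists #|{: 'I_(2 * M) * 'I_(2 * M)}| => d n V d0 Hh Vd.
set P := fun w => _.
have [/hasP[w0 _ /asboolP[q0 _ Vq0]]|] := boolP (has P (cuts n d)); last first.
  by rewrite has_count -leqNgt leqn0 => /eqP ->.
move: (Sw w0 q0) Vq0 => z Vz.
pose h := kappa * omega * d / 5.
have h0 : 0 < h by rewrite divr_gt0 ?mulr_gt0.
have dh : d / h + 2 <= M%:R.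
  rewrite (_ : d / h = 5 / (kappa * omega))// /h; field.
  by rewrite !gt_eqF.
pose grid (g : 'I_(2 * M) * 'I_(2 * M)) (p : 'cV[R]_2) :=
  p 0 0 = z 0 0 + h * (g.1%:R - M%:R) /\ p 1 0 = z 1 0 + h * (g.2%:R - M%:R).
have M0 : (0 < 2 * M)%N.
  by rewrite muln_gt0/= -(ltr_nat R); apply: lt_le_trans MP; rewrite ltr_wpDl// divr_ge0// ltW.
have ex w : exists g, w \in cuts n d -> P w -> exists2 p, U p & grid g (Sw w p).
  have [wc|] := boolP (w \in cuts n d); last by exists (Ordinal M0, Ordinal M0).
  have [/asboolP[q Fq Vq]|] := boolP (P w); last by exists (Ordinal M0, Ordinal M0).
  have dist := Vd _ _ Vq Vz.
  have [/andP[qx1 qx2] /andP[qy1 qy2]] := F_closed_rect Fq.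
  have hw := Hh _ wc.
  have gap side A : omega <= side -> kappa * d <= A -> 4 * h < A * side.
    move=> os kA; apply: (@lt_le_trans _ _ (kappa * d * omega)).
      have kod0 : 0 < kappa * omega * d by rewrite mulr_gt0.
      by rewrite /h; lra.
    by rewrite ler_pM// ltW// mulr_gt0.
  have a0 : \prod_(i <- w) alpha i != 0 by rewrite -normr_gt0 normr_prod; exact: width_gt0.
  have b0 : \prod_(i <- w) beta i != 0 by rewrite -normr_gt0 normr_prod; exact: height_gt0.
  have [u1 [u2 [u12 uin uout]]] := affine_interval (Sw w 0 0 0) a0 x12.
  have [v1 [v2 [v12 vin vout]]] := affine_interval (Sw w 0 1 0) b0 y12.
  have [||||j /uout[px pxU pxE]] := @grid_point R u1 u2 (Sw w q 0 0) (z 0 0) d h M h0.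
  - rewrite u12 normr_prod; apply: gap; last exact: le_trans (height_le_width w).
    by rewrite ge_min lexx.
  - by rewrite Sw_x; apply: uin; rewrite qx1.
  - exact: le_trans (dist_x_le _ _) dist.
  - exact: dh.
  have [||||k /vout[py pyU pyE]] := @grid_point R v1 v2 (Sw w q 1 0) (z 1 0) d h M h0.
  - by rewrite v12 normr_prod; apply: gap; rewrite // ge_min lexx orbT.
  - by rewrite Sw_y; apply: vin; rewrite qy1.
  - exact: le_trans (dist_y_le _ _) dist.
  - exact: dh.
  exists (j, k) => _ _; exists (vec2 px py).
    by split; rewrite ?vec2_x ?vec2_y.
  by split; [rewrite Sw_x vec2_x -pxE|rewrite Sw_y vec2_y -pyE].
have [g gP] := choice ex.
rewrite -size_filter -(size_map g) cardE; apply: uniq_leq_size.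
  rewrite map_inj_in_uniq; first by rewrite filter_uniq// cut_uniq.
  move=> w w'; rewrite !mem_filter => /andP[Pw wc] /andP[Pw' wc'] gg.
  have [p Up [px py]] := gP w wc Pw; have [p' Up' [px' py']] := gP w' wc' Pw'.
  apply: (cut_disjoint wc wc' Up Up'); apply: cV2P.
    by rewrite px px' gg.
  by rewrite py py' gg.
by move=> g' _; rewrite mem_enum.
Qed.

(** The sets V_j that meet the cylinder of w cover it, and projecting and
    rescaling them covers pi_1(F) at scale d / width w.  Summing over w counts
    the pairs (w, V_j) that meet; by [count_cells] each V_j occurs at most C
    times. *)
Lemma cover_F_lower (kappa : R) : 0 < kappa ->
  exists C : nat, forall d n N, 0 < d ->
    (forall w, w \in cuts n d -> kappa * d <= height w) ->
    cover_by (@eucl_dist R 2) F d N ->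
    exists k : seq I -> nat,
      (forall w, w \in cuts n d ->
         cover_by (@real_dist R) (proj1_set F) (d / width w) (k w)) /\
      (\sum_(w <- cuts n d) k w <= N * C)%N.
Proof.
move=> /count_cells[C HC]; exists C => d n N d0 Hh [V [Vd FV]].
pose meets w (j : 'I_N) := `[< exists2 q, F q & V j (Sw w q) >].
exists (fun w => #|finset (meets w)|); split=> [w wc|].
  apply: (@cover_by_fin _ _ _ _ _ (fun j => [set q 0 0 | q in [set q | V j (Sw w q)]])).
    move=> j _ _ _ [p /= Vp <-] [q /= Vq <-].
    rewrite /real_dist ler_pdivlMr ?width_gt0// mulrC -Sw_dist_x.
    exact: le_trans (dist_x_le _ _) (Vd _ _ _ Vp Vq).
  move=> _ [q Fq <-]; have [j _ Vj] := FV _ (Sw_stable w Fq).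
  by exists j; [rewrite inE; apply/asboolP; exists q|exists q].
have -> : (\sum_(w <- cuts n d) #|finset (meets w)| =
    \sum_(j < N) count (fun w => meets w j) (cuts n d))%N.
  under eq_bigr do rewrite cardsE -sum1_card big_mkcond /=.
  rewrite exchange_big /=; apply: eq_bigr => j _.
  by rewrite -sum1_count [RHS]big_mkcond.
rewrite -[X in (_ <= X * _)%N]card_ord -sum_nat_const.
by apply: leq_sum => j _; exact: HC.
Qed.

(** * Box dimension of F *)

(** The cost of a cylinder of width X and height Y at scale d, compared with its
    weight.  In the uses e is small of either sign, X <= 1, and Y / d lies
    between two positive constants. *)
Lemma cell_weight (s1 e s X Y d : R) : 0 < X -> 0 < Y -> 0 < d ->
  (d / X) `^ (- (s1 + e)) =
  X `^ e * (Y / d) `^ (s1 - s) * (X `^ s1 * Y `^ (s - s1)) * d `^ (- (s + e)).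
Proof.
move=> X0 Y0 d0; rewrite !powR_expR ?divr_gt0// -!expRD !ln_div//.
by congr expR; ring.
Qed.

Variables (s1 s kappa : R).
Hypothesis F_neq0 : F !=set0.
Hypothesis kappa_gt0 : 0 < kappa.
Hypothesis kappa_le : forall i, kappa <= `|beta i|.
Hypothesis weight_sum : \sum_i `|alpha i| `^ s1 * `|beta i| `^ (s - s1) = 1.
Hypothesis proj_le : box_le (@real_dist R) (proj1_set F) s1.
Hypothesis proj_ge : box_ge (@real_dist R) (proj1_set F) s1.

Definition weight w := width w `^ s1 * height w `^ (s - s1).

Lemma weight_cut n d : \sum_(w <- cuts n d) weight w = 1.
Proof.
rewrite -[RHS](sum_cut (fun i => `|beta i|) n d weight_sum); apply: eq_bigr => w _.
rewrite /weight /width /height; elim: w => [|i w IH]; first by rewrite !big_nil !powR1 mulr1.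
by rewrite !big_cons !powRM ?prodr_ge0// -IH mulrACA.
Qed.

Lemma weight_ge0 w : 0 <= weight w.
Proof. by rewrite mulr_ge0// powR_ge0. Qed.

Lemma cut_depth d : 0 < d -> exists n, lambda ^+ n <= d.
Proof.
have l01 : 0 <= lambda < 1 by have := lambda_lt1; lra.
by move=> d0; have [n] := exists_exp_lt 1 l01 d0; rewrite mul1r => /ltW; exists n.
Qed.

Lemma kappa_le1 : kappa <= 1.
Proof.
have [p /F_preimage[i _]] := F_neq0.
apply: le_trans (kappa_le i) (le_trans (beta_le i) (ltW (alpha_lt1 i))).
Qed.

Lemma cut_height n d w : 0 < d < 1 -> lambda ^+ n <= d -> w \in cuts n d ->
  kappa * d <= height w <= d.
Proof.
move=> /andP[d0 d1] ld wc; apply/andP; split.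
  apply: (cut_ge (b := fun i => `|beta i|)) wc => //; first exact: beta_gt0.
  by rewrite (le_trans (ltW d1))// invf_ge1 ?kappa_le1.
apply: (cut_le (b := fun i => `|beta i|) beta_gt0 _ _ ld wc).
  by have /andP[] := lambda_lt1.
by move=> i; exact: le_trans (beta_le i) (alpha_le i).
Qed.

Lemma cut_ratio n d w : 0 < d < 1 -> lambda ^+ n <= d -> w \in cuts n d ->
  0 < d / width w <= kappa^-1.
Proof.
move=> d01 ld wc; have /andP[d0 _] := d01; have /andP[kd _] := cut_height d01 ld wc.
rewrite divr_gt0 ?width_gt0//= ler_pdivrMr ?width_gt0// mulrC ler_pdivlMr//.
by rewrite mulrC (le_trans kd)// height_le_width.
Qed.

(** Over a cut the costs of the cylinders, rewritten by [cell_weight], are the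
    weights times a bounded factor times d^(-(s + e)), and the weights sum to
    1. *)
Lemma box_le_F : box_le (@eucl_dist R 2) F s.
Proof.
have [p Fp] := F_neq0.
have H0 : 0 <= H by apply: le_trans (F_x_bounded Fp Fp).
have H1 : 0 < 1 + H by lra.
move=> e e0; have ki0 : 0 < kappa^-1 by rewrite invr_gt0.
have [K K0 HK] := box_le_large proj_le e0 ki0.
pose K2 := Num.max (kappa `^ (s1 - s)) (1 `^ (s1 - s)).
have K20 : 0 < K2 by rewrite lt_max powR_gt0.
exists (K * K2 * (1 + H)^-1 `^ (- (s + e))), (1 + H); split=> //.
  by rewrite !mulr_gt0// powR_gt0// invr_gt0.
(* [cover_F_upper] covers at scale (1 + H) * d. *)
move=> d' /andP[d'0 d'H]; pose d := (1 + H)^-1 * d'.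
have d01 : 0 < d < 1.
  by rewrite /d mulr_gt0 ?invr_gt0//= mulrC ltr_pdivrMr// mul1r.
have /andP[d0 d1] := d01; have [n ld] := cut_depth d0.
have ex w : exists k, w \in cuts n d ->
    cover_by (@real_dist R) (proj1_set F) (d / width w) k /\
    k%:R <= K * K2 * d `^ (- (s + e)) * weight w.
  have [wc|] := boolP (w \in cuts n d); last by exists 0%N.
  have [k [kc kK]] := HK _ (cut_ratio d01 ld wc); exists k => _; split=> //.
  apply: (le_trans kK).
  rewrite (cell_weight s1 e s (width_gt0 w) (height_gt0 w) d0) -/(weight w).
  have /andP[hd1 hd2] := cut_height d01 ld wc.
  have hr : kappa <= height w / d <= 1 by rewrite ler_pdivlMr// hd1 ler_pdivrMr// mul1r.
  have /andP[_ hp] := powR_between (s1 - s) kappa_gt0 hr.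
  have wp : width w `^ e <= 1.
    have := ge0_ler_powR (ltW e0) _ _ (width_le1 w).
    by rewrite powR1; apply; rewrite nnegrE// ltW// width_gt0.
  have main : width w `^ e * (height w / d) `^ (s1 - s) <= K2.
    by rewrite -[leRHS]mul1r ler_pM ?powR_ge0.
  rewrite [leRHS](_ : _ = K * (K2 * weight w * d `^ (- (s + e)))); last by ring.
  rewrite ler_pM2l// ler_pM2r ?powR_gt0//.
  by apply: ler_wpM2r => //; exact: weight_ge0.
have [k kP] := choice ex.
exists (\sum_(w <- cuts n d) k w)%N; split.
  have -> : d' = (1 + H) * d by rewrite /d mulVKf// gt_eqF.
  by apply: cover_F_upper => // w /kP[].
rewrite natr_sum; apply: (@le_trans _ _ (\sum_(w <- cuts n d) K * K2 * d `^ (- (s + e)) * weight w)).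
  by rewrite !big_seq; apply: ler_sum => w /kP[].
by rewrite -mulr_sumr weight_cut mulr1 /d powRM ?invr_ge0 ?(ltW H1) ?(ltW d'0)// mulrA.
Qed.

(** As for [box_le_F], with - e in place of e, the factor now being bounded
    below. *)
Lemma box_ge_F : box_ge (@eucl_dist R 2) F s.
Proof.
move=> e e0; have ki0 : 0 < kappa^-1 by rewrite invr_gt0.
have P0 : proj1_set F !=set0 by have [p Fp] := F_neq0; exists (p 0 0), p.
have [c c0 Hc] := box_ge_large P0 proj_ge e0 ki0.
have [C HC] := cover_F_lower kappa_gt0.
pose k2 := Num.min (kappa `^ (s1 - s)) (1 `^ (s1 - s)).
have k20 : 0 < k2 by rewrite lt_min !powR_gt0.
(* C may be 0, whence the denominator C.+1. *)
exists (c * k2 / C.+1%:R), 1; split=> //; first by rewrite divr_gt0 ?mulr_gt0.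
move=> d N d01 FN; have /andP[d0 d1] := d01; have [n ld] := cut_depth d0.
have [|k [kc kN]] := HC d n N d0 _ FN.
  by move=> w wc; have /andP[] := cut_height d01 ld wc.
rewrite mulrAC ler_pdivrMr//; apply: (@le_trans _ _ (\sum_(w <- cuts n d) k w)%N%:R).
  rewrite natr_sum.
  apply: (@le_trans _ _ (\sum_(w <- cuts n d) c * k2 * d `^ (- (s - e)) * weight w)).
    by rewrite -mulr_sumr weight_cut mulr1.
  rewrite !big_seq; apply: ler_sum => w wc.
  apply: le_trans (Hc _ _ (cut_ratio d01 ld wc) (kc _ wc)).
  rewrite (cell_weight s1 (- e) s (width_gt0 w) (height_gt0 w) d0) -/(weight w).
  have /andP[hd1 hd2] := cut_height d01 ld wc.
  have hr : kappa <= height w / d <= 1 by rewrite ler_pdivlMr// hd1 ler_pdivrMr// mul1r.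
  have /andP[hp _] := powR_between (s1 - s) kappa_gt0 hr.
  have wp : 1 <= width w `^ (- e).
    rewrite -[leLHS](powRr0 (width w)); apply: ger_powR.
      by rewrite width_gt0 width_le1.
    by rewrite oppr_le0 ltW.
  have main : k2 <= width w `^ (- e) * (height w / d) `^ (s1 - s).
    by rewrite -[leLHS]mul1r ler_pM// ltW.
  rewrite [leLHS](_ : _ = c * (k2 * weight w * d `^ (- (s - e)))); last by ring.
  rewrite ler_pM2l// ler_pM2r ?powR_gt0//.
  by apply: ler_wpM2r => //; exact: weight_ge0.
rewrite -natrM ler_nat (leq_trans kN)// leq_mul2l leqnSn orbT//.
Qed.

(** * Packing dimension of F from below *)

(** A cylinder is F up to a change of scale by a factor at least height w, so its
    dimension is at least that of F. *)
Lemma cylinder_box_ge E u w : box_le (@eucl_dist R 2) E u -> Sw w @` F `<=` E -> s <= u.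
Proof.
move=> Eu wE; apply: (box_dim_le_of box_ge_F).
have hi0 : 0 < (height w)^-1 by rewrite invr_gt0 height_gt0.
apply: (box_le_transfer hi0 _ Eu) => d n d0 En.
by rewrite mulrC; apply: cover_by_cylinder; exact: cover_by_sub wE En.
Qed.

(** The closure of E misses a point of the cylinder of w by [cylinder_box_ge];
    any long enough extension w ++ v whose cylinder contains this point has its
    cylinder entirely at distance at least eta from E. *)
Lemma escape_adherence E u w : box_le (@eucl_dist R 2) (adherence (@eucl_dist R 2) E) u ->
  u < s -> exists v eta, 0 < eta /\
    forall q x, F q -> E x -> eta <= eucl_dist x (Sw (w ++ v) q).
Proof.
move=> Eu us.
have [q [Fq qE]] : exists q, F q /\ ~ adherence (@eucl_dist R 2) E (Sw w q).
  apply: contrapT => nex; move: us; rewrite ltNge => /negP; apply.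
  apply: (cylinder_box_ge (w := w) Eu) => _ [q Fq <-].
  by apply: contrapT => nq; apply: nex; exists q.
have [e [e0 far]] : exists e, 0 < e /\ forall x, E x -> e < eucl_dist x (Sw w q).
  apply: contrapT => nex; apply: qE => e e0; apply: contrapT => nx; apply: nex.
  exists e; split=> // x Ex; rewrite ltNge; apply/negP => xe; apply: nx.
  by exists x.
have l01 : 0 <= lambda < 1 by have := lambda_lt1; lra.
have [m Hm] := exists_exp_lt (2 * H) l01 (divr_gt0 e0 (ltr0Sn R 1)).
have [v [q' [sv Fq' qE']]] := word_cover m Fq.
exists v, (e / 2); split; first exact: divr_gt0.
move=> r x Fr Ex; have ex := far x Ex.
have wv : width (w ++ v) <= lambda ^+ m.
  rewrite /width big_cat -/(width w) -/(width v) /= -[leRHS]mul1r.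
  apply: ler_pM; [exact/ltW/width_gt0|exact/ltW/width_gt0|exact: width_le1|].
  by rewrite -sv; exact: width_le.
have close : eucl_dist (Sw (w ++ v) r) (Sw w q) <= e / 2.
  rewrite qE' -Sw_cat; apply: le_trans (dist_le_xy _ _) (le_trans _ (ltW Hm)).
  rewrite Sw_dist_x Sw_dist_y.
  rewrite [leRHS](_ : _ = lambda ^+ m * H + lambda ^+ m * H); last by ring.
  apply: lerD; apply: ler_pM => //.
  - exact/ltW/width_gt0.
  - exact: F_x_bounded.
  - exact/ltW/height_gt0.
  - exact: le_trans (height_le_width _) wv.
  - exact: F_y_bounded.
by have := eucl_distD x (Sw (w ++ v) r) (Sw w q); lra.
Qed.

Hypothesis F_clusters : forall u : nat -> 'cV[R]_2, (forall k, F (u k)) ->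
  exists p, F p /\ forall e n, 0 < e -> exists j, (n <= j)%N /\ eucl_dist p (u j) <= e.

(** Starting from the empty word, [escape_adherence] extends the current word so
    as to leave the closure of V k at step k.  A cluster point p of points of the
    nested cylinders is at positive distance from each V k. *)
Lemma packing_dim_F_ge : (s%:E <= packing_dim (@eucl_dist R 2) F)%E.
Proof.
apply: (packing_dim_ge (@eucl_dist0 R) (@eucl_distC R) (@eucl_distD R) 0) => V u FV u0 us.
apply: contrapT => nk.
have Vu k : box_le (@eucl_dist R 2) (adherence (@eucl_dist R 2) (V k)) u.
  by apply: contrapT => nb; apply: nk; exists k.
have ex (kw : nat * seq I) : exists v, exists eta, 0 < eta /\
    forall q x, F q -> V kw.1 x -> eta <= eucl_dist x (Sw (kw.2 ++ v) q).
  exact: escape_adherence (Vu kw.1) us.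
have [f fP] := choice ex.
(* The k-th extension escapes from the k-th set of the cover. *)
pose W := fix W n := if n is m.+1 then W m ++ f (m, W m) else [::].
have Wext j n : exists v, W (n + j)%N = W n ++ v.
  elim: j => [|j [v IH]]; first by exists [::]; rewrite addn0 cats0.
  by rewrite addnS /= IH; exists (v ++ f ((n + j)%N, W n ++ v)); rewrite catA.
have [q0 Fq0] := F_neq0.
have [|p [Fp acc]] := F_clusters (u := fun k => Sw (W k) q0).
  by move=> k; exact: Sw_stable.
have [k _ padh] := FV _ Fp.
have [eta [eta0 far]] := fP (k, W k).
have e40 : 0 < eta / 4 by rewrite divr_gt0.
have [x Vx xp] := padh _ e40.
have [j [kj pj]] := acc _ k.+1 e40.
have [v Wj] := Wext (j - k.+1)%N k.+1; rewrite subnKC// in Wj.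
have := far (Sw v q0) x (Sw_stable v Fq0) Vx.
have -> : Sw ((k, W k).2 ++ f (k, W k)) (Sw v q0) = Sw (W j) q0.
  by rewrite Wj -Sw_cat.
by have := eucl_distD x p (Sw (W j) q0); lra.
Qed.

End OpenRectangle.
End IFS.

(** * Diagonal linear parts *)

Section DiagonalMatrices.
Variable R : realType.
Implicit Types (a b c d l : R) (M N : 'M[R]_2) (p : 'cV[R]_2).

Lemma mulmx2 M p i : (M *m p) i 0 = M i 0 * p 0 0 + M i 1 * p 1 0.
Proof. by rewrite mxE big_ord_recl big_ord1 (_ : lift _ _ = 1)//; apply: val_inj. Qed.

Lemma I2P (P : 'I_2 -> Prop) : P 0 -> P 1 -> forall i, P i.
Proof.
move=> P0 P1 i; have [->|->//] : i = 0 \/ i = 1; last by [].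
by case: i => [[|[|//]]] ?; [left|right]; apply: val_inj.
Qed.

Lemma mx2P M N : M 0 0 = N 0 0 -> M 0 1 = N 0 1 -> M 1 0 = N 1 0 -> M 1 1 = N 1 1 -> M = N.
Proof. by move=> h00 h01 h10 h11; apply/matrixP; apply: I2P; apply: I2P. Qed.

Lemma diag2E a b i j : diag2 a b i j = (if i == 0 then a else b) *+ (i == j).
Proof. by rewrite /diag2 !mxE. Qed.

Lemma diag2_mulmx a b M : diag2 a b *m M =
  \matrix_(i, j) ((if i == 0 then a else b) * M i j).
Proof. by rewrite /diag2 mul_diag_mx; apply/matrixP => i j; rewrite !mxE. Qed.

Lemma diag2M a b c d : diag2 a b *m diag2 c d = diag2 (a * c) (b * d).
Proof.
by rewrite diag2_mulmx; apply: mx2P; rewrite !mxE /= ?mulr0 ?mulr0n ?mulr1n.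
Qed.

Lemma diag2_prod (I : Type) (w : seq I) (f g : I -> R) :
  \prod_(i <- w) diag2 (f i) (g i) = diag2 (\prod_(i <- w) f i) (\prod_(i <- w) g i).
Proof.
elim: w => [|i w IH]; last by rewrite !big_cons IH -diag2M.
by rewrite !big_nil; apply: mx2P; rewrite !mxE.
Qed.

Lemma affine_diag2_x a b t p : affine_map (diag2 a b) t p 0 0 = a * p 0 0 + t 0 0.
Proof. by rewrite /affine_map mxE mulmx2 !diag2E /= mulr0n mul0r addr0. Qed.

Lemma affine_diag2_y a b t p : affine_map (diag2 a b) t p 1 0 = b * p 1 0 + t 1 0.
Proof. by rewrite /affine_map mxE mulmx2 !diag2E /= mulr0n mul0r add0r. Qed.

Lemma eucl_norm_sqr p : eucl_norm p ^+ 2 = p 0 0 ^+ 2 + p 1 0 ^+ 2.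
Proof.
rewrite /eucl_norm sqr_sqrtr; last by apply: sumr_ge0 => i _; exact: sqr_ge0.
by rewrite big_ord_recl big_ord1 (_ : lift _ _ = 1)//; apply: val_inj.
Qed.

(** The first column of L is horizontal because horizontal lines stay horizontal;
    the columns of an isometry are orthonormal, so L is diagonal with entries 1
    or -1. *)
Lemma isometry_diagonal a b (L : 'M[R]_2) t : 0 < a -> 0 < b ->
  (forall x : 'cV[R]_2, eucl_norm (L *m x) = eucl_norm x) ->
  (forall h, horizontal_line h -> horizontal_line (affine_map (diag2 a b *m L) t @` h)) ->
  exists alpha beta, [/\ diag2 a b *m L = diag2 alpha beta, `|alpha| = a & `|beta| = b].
Proof.
move=> a0 b0 isoL horS.
have iso x y : (L 0 0 * x + L 0 1 * y) ^+ 2 + (L 1 0 * x + L 1 1 * y) ^+ 2 = x ^+ 2 + y ^+ 2.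
  by have := eucl_norm_sqr (vec2 x y); rewrite -isoL eucl_norm_sqr !mulmx2 vec2_x vec2_y.
have L10 : L 1 0 = 0.
  have [|c hc] := horS [set p | p 1 0 = 0]; first by exists 0.
  have hy x : b * (L 1 0 * x) + t 1 0 = c.
    have : (affine_map (diag2 a b *m L) t @` [set p : 'cV[R]_2 | p 1 0 = 0]) (affine_map (diag2 a b *m L) t (vec2 x 0)).
      by exists (vec2 x 0) => //=; rewrite vec2_y.
    rewrite hc /= => <-.
    by rewrite /affine_map mxE mulmx2 vec2_x vec2_y mulr0 addr0 diag2_mulmx mxE /= mulrA.
  have /eqP : b * L 1 0 = 0 by have := hy 1; have := hy 0; lra.
  by rewrite mulf_eq0 gt_eqF//= => /eqP.
have h10 := iso 1 0; have h01 := iso 0 1; have h11 := iso 1 1.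
rewrite L10 !mul0r !mulr0 !mulr1 ?addr0 ?add0r expr1n expr0n/= ?addr0 ?add0r in h10 h01 h11.
have L01 : L 0 1 = 0.
  have h : L 0 0 * L 0 1 = 0 by lra.
  have L00 : L 0 0 != 0 by apply/eqP => e; rewrite e expr0n /= in h10; lra.
  by move/eqP: h; rewrite mulf_eq0 (negbTE L00) => /eqP.
rewrite L01 expr0n /= add0r in h01.
exists (a * L 0 0), (b * L 1 1); split.
- by rewrite diag2_mulmx; apply: mx2P; rewrite !mxE /= ?L10 ?L01 ?mulr0.
- by rewrite normrM gtr0_norm//; have /eqP := h10; rewrite sqrf_eq1 => /orP[]/eqP->; rewrite ?normrN normr1 mulr1.
- by rewrite normrM gtr0_norm//; have /eqP := h01; rewrite sqrf_eq1 => /orP[]/eqP->; rewrite ?normrN normr1 mulr1.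
Qed.

Lemma eigenvalue_diag2 a b l : eigenvalue (diag2 a b) l = (l == a) || (l == b).
Proof.
apply/eigenvalueP/orP.
  move=> [v vM v0].
  have e0 : v 0 0 * a = l * v 0 0.
    have := congr1 (fun m : 'rV_2 => m 0 0) vM.
    by rewrite /= mxE big_ord_recl big_ord1 !diag2E /= mulr0n mulr0 addr0 mulr1n mxE.
  have e1 : v 0 1 * b = l * v 0 1.
    have := congr1 (fun m : 'rV_2 => m 0 1) vM.
    rewrite /= mxE big_ord_recl big_ord1 (_ : lift _ _ = 1); last exact: val_inj.
    by rewrite !diag2E /= mulr0n mulr0 add0r mulr1n mxE.
  have [v00|v00] := eqVneq (v 0 0) 0.
    have v01 : v 0 1 != 0.
      apply: contraNneq v0 => v01; apply/eqP/matrixP => i; rewrite ord1.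
      by apply: I2P; rewrite mxE.
    by right; apply/eqP; apply: (mulIf v01); rewrite -e1 mulrC.
  by left; apply/eqP; apply: (mulIf v00); rewrite -e0 mulrC.
move=> [/eqP ->|/eqP ->].
  exists (delta_mx 0 0).
    apply/matrixP => i; rewrite ord1; apply: I2P;
    by rewrite !mxE big_ord_recl big_ord1 !mxE /= ?mul1r ?mul0r ?mulr0n ?mulr1n ?addr0 ?mulr1 ?mulr0.
  by apply/eqP => /matrixP/(_ 0 0)/eqP; rewrite !mxE /= oner_eq0.
exists (delta_mx 0 1).
  apply/matrixP => i; rewrite ord1; apply: I2P;
  by rewrite !mxE big_ord_recl big_ord1 !mxE /= ?mul1r ?mul0r ?mulr0n ?mulr1n ?addr0 ?add0r ?mulr1 ?mulr0.
by apply/eqP => /matrixP/(_ 0 1)/eqP; rewrite !mxE /= oner_eq0.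
Qed.

Lemma sing_set_diag2 a b :
  [set Num.sqrt l | l in [set l | eigenvalue ((diag2 a b)^T *m diag2 a b) l]] =
  [set `|a|; `|b|].
Proof.
have -> : (diag2 a b)^T = diag2 a b by apply: mx2P; rewrite !mxE.
rewrite diag2M -!expr2; apply/seteqP; split => [_ [l /= + <-]|_ [->|->]].
- by rewrite eigenvalue_diag2 => /orP[]/eqP ->; rewrite sqrtr_sqr; [left|right].
- by exists (a ^+ 2); rewrite /= ?eigenvalue_diag2 ?eqxx// sqrtr_sqr.
- by exists (b ^+ 2); rewrite /= ?eigenvalue_diag2 ?eqxx ?orbT// sqrtr_sqr.
Qed.

Lemma sing1_diag2 a b : sing1 (diag2 a b) = Num.max `|a| `|b|.
Proof.
rewrite /sing1 sing_set_diag2; apply/eqP; rewrite eq_le; apply/andP; split.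
  apply: ge_sup; first by exists `|a|; left.
  by move=> _ [->|->]; rewrite le_max lexx ?orbT.
have ub : has_ubound [set `|a|; `|b|].
  by exists (Num.max `|a| `|b|) => _ [->|->]; rewrite le_max lexx ?orbT.
by rewrite ge_max; apply/andP; split; apply: ub_le_sup => //; [left|right].
Qed.

Lemma sing2_diag2 a b : sing2 (diag2 a b) = Num.min `|a| `|b|.
Proof.
rewrite /sing2 sing_set_diag2; apply/eqP; rewrite eq_le; apply/andP; split.
  have lb : has_lbound [set `|a|; `|b|].
    by exists (Num.min `|a| `|b|) => _ [->|->]; rewrite ge_min lexx ?orbT.
  by rewrite le_min; apply/andP; split; apply: ge_inf => //; [left|right].
apply: lb_le_inf; first by exists `|a|; left.
by move=> _ [->|->]; rewrite ge_min lexx ?orbT.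
Qed.

(** The image of the unit square has width |a|, which by assumption is the larger
    singular value. *)
Lemma horizontal_diag2 a b t :
  horizontal_sing1 (diag2 a b) (affine_map (diag2 a b) t) -> `|b| <= `|a|.
Proof.
move=> [x [y imE]].
have s10 : 0 <= sing1 (diag2 a b) by rewrite sing1_diag2 le_max normr_ge0.
have s20 : 0 <= sing2 (diag2 a b) by rewrite sing2_diag2 le_min !normr_ge0.
have pre z : x <= z <= x + sing1 (diag2 a b) -> exists2 p0, 0 <= p0 <= 1 & a * p0 + t 0 0 = z.
  move=> zx; have : closed_rect x (x + sing1 (diag2 a b)) y (y + sing2 (diag2 a b)) (vec2 z y).
    by rewrite /closed_rect /= vec2_x vec2_y lexx lerDl.
  rewrite -imE => -[p [p0 _] /(congr1 (fun q : 'cV_2 => q 0 0))].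
  by rewrite affine_diag2_x vec2_x => e; exists (p 0 0).
have [|p p01 px] := pre x; first by rewrite lexx lerDl.
have [|q q01 qx] := pre (x + sing1 (diag2 a b)); first by rewrite lexx lerDl s10.
have : sing1 (diag2 a b) <= `|a|.
  have -> : sing1 (diag2 a b) = a * (q - p) by lra.
  apply: le_trans (ler_norm _) _; rewrite normrM -[leRHS]mulr1 ler_wpM2l//.
  by rewrite ler_norml; lra.
by rewrite sing1_diag2 ge_max => /andP[].
Qed.

End DiagonalMatrices.

(** * The dimension equation and bounded plane sets *)

Section DimensionEquation.
Variables (R : realType) (I : finType) (a b : I -> R) (s1 : R).
Hypothesis I_gt0 : (0 < #|I|)%N.
Hypothesis a_gt0 : forall i, 0 < a i.
Hypothesis b01 : forall i, 0 < b i < 1.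

Let g (u : R) : R := \sum_i a i `^ s1 * b i `^ (u - s1).

Lemma term_solve i (c : R) : 0 < c -> exists u, a i `^ s1 * b i `^ (u - s1) = c.
Proof.
move=> c0; have b0 : 0 < b i by have /andP[] := b01 i.
exists (s1 + (ln c - s1 * ln (a i)) / ln (b i)).
rewrite !powR_expR// -expRD addrAC subrr add0r divfK; last by rewrite lt_eqF// ln_lt0.
by rewrite addrC subrK lnK.
Qed.

Lemma term_decr i (u v : R) : u < v ->
  a i `^ s1 * b i `^ (v - s1) < a i `^ s1 * b i `^ (u - s1).
Proof.
by move=> uv; rewrite ltr_pM2l ?powR_gt0//; apply: powR_gt => //; rewrite ltrD2r.
Qed.

Lemma dimension_sum_decr (u v : R) : u < v -> g v < g u.
Proof.
move=> uv; have /card_gt0P[i0 _] := I_gt0.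
rewrite /g (bigD1 i0)//= [ltRHS](bigD1 i0)//= ltr_leD ?term_decr//.
by apply: ler_sum => i _; exact/ltW/term_decr.
Qed.

(** The sum is continuous and strictly decreasing in u.  It is at least 1 where
    one term equals 1, and at most 1 where every term has dropped to 1 / #|I|. *)
Lemma dimension_equation : exists2 s, g s = 1 & forall u, g u = 1 -> u = s.
Proof.
have /card_gt0P[i0 _] := I_gt0.
have [u0 Hu0] := term_solve i0 ltr01.
have n0 : 0 < (#|I|%:R : R) by rewrite ltr0n.
have ninv : 0 < (#|I|%:R : R)^-1 by rewrite invr_gt0.
have [v Hv] := choice (fun i => term_solve i ninv).
pose u1 := \big[Num.max/u0]_i v i.
have u01 : u0 <= u1 by exact: bigmax_ge_id.
have g0 : 1 <= g u0.
  rewrite /g (bigD1 i0)//= Hu0 lerDl; apply: sumr_ge0 => i _.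
  by rewrite mulr_ge0 ?powR_ge0.
have g1 : g u1 <= 1.
  apply: (@le_trans _ _ (\sum_(i : I) (#|I|%:R)^-1)); last first.
    by rewrite sumr_const -[leLHS]mulr_natr mulVf// gt_eqF.
  apply: ler_sum => i _; rewrite -(Hv i); have := le_bigmax u0 v i.
  by rewrite -/u1 le_eqVlt => /predU1P[->//|/(term_decr i)/ltW].
have cg : continuous g.
  rewrite /g; elim: (index_enum I) => [|i r IH] u.
    by rewrite (_ : (fun _ => _) = cst 0); [exact: cvg_cst|apply/funext => v'; rewrite big_nil].
  rewrite (_ : (fun _ => _) = (fun u => a i `^ s1 * expR ((u - s1) * ln (b i))) \+
      (fun u => \sum_(j <- r) a j `^ s1 * b j `^ (u - s1))); last first.
    by apply/funext => v'; rewrite big_cons /= (powR_expR (a := b i))//; have /andP[] := b01 i.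
  apply: cvgD; last exact: IH.
  apply: cvgMr; apply: (continuous_comp (f := fun u => (u - s1) * ln (b i)) (g := @expR R)).
    by apply: cvgMl; apply: cvgB; [exact: cvg_id|exact: cvg_cst].
  exact: continuous_expR.
have [|s _ gs] := IVT (v := 1) u01 (continuous_subspaceT cg).
  by rewrite ge_min le_max g0 g1 ?orbT.
exists s => // u gu; apply/eqP; case: (ltgtP u s) => // us;
  have := dimension_sum_decr us; by rewrite gs gu ltxx.
Qed.

End DimensionEquation.

Section PlaneSets.
Variable R : realType.
Implicit Types (F : set 'cV[R]_2).

(** F lies in a square of side 2 * H, which m * m cells of side d / 2 cover. *)
Lemma box_le_plane F (H : R) : F !=set0 ->
  (forall p q, F p -> F q -> `|p 0 0 - q 0 0| <= H) ->
  (forall p q, F p -> F q -> `|p 1 0 - q 1 0| <= H) ->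
  box_le (@eucl_dist R 2) F 2.
Proof.
move=> [p0 Fp0] Hx Hy e e0.
have H0 : 0 <= H by apply: le_trans (Hx _ _ Fp0 Fp0).
exists ((4 * H + 1) ^+ 2), 1; split=> //; first by rewrite exprn_gt0//; lra.
move=> d /andP[d0 d1].
pose m := (Num.truncn (4 * H / d)).+1.
have h0 : 0 < d / 2 by lra.
have hm : 4 * H / d < m%:R by apply: truncnS_gt.
have hm' : m%:R <= (4 * H + 1) / d.
  rewrite /m -[leLHS]natr1 [leRHS]mulrDl mul1r; apply: lerD; last by rewrite invf_ge1// ltW.
  by rewrite truncn_le// divr_ge0// ?mulr_ge0// ltW.
have cell x c : `|x - c| <= H -> exists j : 'I_m,
    c - H + j%:R * (d / 2) <= x <= c - H + (j%:R + 1) * (d / 2).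
  rewrite ler_norml => /andP[xc1 xc2]; pose y := (x - c + H) / (d / 2).
  have y0 : 0 <= y by apply: divr_ge0; lra.
  have yx : x = c - H + y * (d / 2) by rewrite /y divfK ?gt_eqF//; lra.
  have /andP[yj yj1] := truncn_itv y0.
  have jm : (Num.truncn y < m)%N.
    rewrite -(ltr_nat R); apply: le_lt_trans yj (le_lt_trans _ hm).
    by rewrite /y ler_pdivrMr// mulrA divfK ?gt_eqF//; lra.
  exists (Ordinal jm) => /=; rewrite -natr1 in yj1.
  by rewrite yx !lerD2l !ler_pM2r// yj ltW.
exists #|[set: 'I_m * 'I_m]%SET|; split; last first.
  rewrite cardsT card_prod card_ord natrM.
  apply: (@le_trans _ _ (((4 * H + 1) / d) * ((4 * H + 1) / d))); first exact: ler_pM.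
  rewrite mulf_div -!expr2 ler_pM2l; last by rewrite exprn_gt0//; lra.
  rewrite -(powR_mulrn 2 (ltW d0)) -powRN; apply: ger_powR; first by rewrite d0 ltW.
  by rewrite opprD gerDl oppr_le0 ltW.
apply: (cover_by_fin (U := fun jk : 'I_m * 'I_m => [set p : 'cV[R]_2 |
   (p0 0 0 - H + jk.1%:R * (d / 2) <= p 0 0 <= p0 0 0 - H + (jk.1%:R + 1) * (d / 2)) /\
   (p0 1 0 - H + jk.2%:R * (d / 2) <= p 1 0 <= p0 1 0 - H + (jk.2%:R + 1) * (d / 2))])).
  move=> [j k] _ p q /= [px py] [qx qy]; apply: le_trans (dist_le_xy _ _) _.
  have hx : `|p 0 0 - q 0 0| <= d / 2 by rewrite ler_norml; lra.
  have hy : `|p 1 0 - q 1 0| <= d / 2 by rewrite ler_norml; lra.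
  by lra.
move=> p Fp; have [j hj] := cell _ _ (Hx _ _ Fp Fp0); have [k hk] := cell _ _ (Hy _ _ Fp Fp0).
by exists (j, k) => //; rewrite inE.
Qed.

Lemma compact_plane_bounded F : compact F -> exists H : R,
  (forall p q, F p -> F q -> `|p 0 0 - q 0 0| <= H) /\
  (forall p q, F p -> F q -> `|p 1 0 - q 1 0| <= H).
Proof.
move=> /compact_bounded [M [_ HM]].
have M1 : M < M + 1 by rewrite ltrDl.
have entry p i : F p -> `|p i 0| <= M + 1.
  move=> Fp; apply: le_trans (HM _ M1 p Fp); rewrite [leRHS]mx_normrE.
  exact: (le_bigmax 0 (fun ij : 'I_2 * 'I_1 => `|p ij.1 ij.2|) (i, 0)).
exists (2 * (M + 1)); split=> p q Fp Fq; apply: le_trans (ler_normB _ _) _;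
  by have := entry p 0 Fp; have := entry q 0 Fq; have := entry p 1 Fp; have := entry q 1 Fq; lra.
Qed.

Lemma compact_plane_clusters F : compact F -> forall u : nat -> 'cV[R]_2,
  (forall k, F (u k)) ->
  exists p, F p /\ forall e n, 0 < e -> exists j, (n <= j)%N /\ eucl_dist p (u j) <= e.
Proof.
move=> cF u Fu.
have [|p [Fp cl]] := cF (u @ \oo) _.
  by exists 0%N => // k _ /=; exact: Fu.
exists p; split=> // e n e0.
have e20 : 0 < e / 2 by rewrite divr_gt0.
have [||q [[j nj] [<- bq]]] := cl (u @` [set j | (n <= j)%N]) (ball p (e / 2)).
- by exists n => // j nj; exists j.
- exact: nbhsx_ballx.
exists j; split=> //; apply: le_trans (dist_le_xy _ _) _.
case: bq => _ bq; have := bq 0 0; have := bq 1 0; rewrite /ball /= => b1 b0.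
lra.
Qed.

End PlaneSets.

(** * Affinity dimension *)

Section AffinityDimension.
Variable R : realType.
Implicit Types (u s x y : R).

(** The singular value function in terms of the two singular values x >= y. *)
Definition phi u x y : R :=
  if u == 0 then 1 else if u <= 1 then x `^ u
  else if u <= 2 then x * y `^ (u - 1) else (x * y) `^ (u / 2).

Lemma phiM u x y x' y' : 0 <= x -> 0 <= y -> 0 <= x' -> 0 <= y' ->
  phi u (x * x') (y * y') = phi u x y * phi u x' y'.
Proof.
move=> x0 y0 x'0 y'0; rewrite /phi; case: ifP => _; first by rewrite mulr1.
case: ifP => _; first by rewrite powRM.
case: ifP => _; first by rewrite powRM// mulrACA.
by rewrite [in LHS]mulrACA [LHS]powRM// mulr_ge0.
Qed.

Lemma phi_prod (I : Type) (w : seq I) (f g : I -> R) u :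
  (forall i, 0 <= f i) -> (forall i, 0 <= g i) ->
  phi u (\prod_(i <- w) f i) (\prod_(i <- w) g i) = \prod_(i <- w) phi u (f i) (g i).
Proof.
move=> f0 g0; elim: w => [|i w IH].
  by rewrite !big_nil /phi mulr1 powR1 /= mulr1; do 3?case: ifP.
by rewrite !big_cons phiM ?IH ?prodr_ge0.
Qed.

Lemma phi_ge0 u x y : 0 <= x -> 0 <= phi u x y.
Proof.
by move=> x0; rewrite /phi; do 3?case: ifP => _; rewrite ?powR_ge0 ?mulr_ge0 ?powR_ge0.
Qed.

(** For 1 <= s <= 2 the value of phi at s is x * y^(s - 1), also at s = 1, where
    another branch applies. *)
Lemma phi_ge s u x y : 0 < y -> y <= x -> x < 1 -> 1 <= s <= 2 -> 0 <= u -> u < s ->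
  x * y `^ (s - 1) <= phi u x y.
Proof.
move=> y0 yx x1 /andP[s1 s2] u0 us.
have x0 := lt_le_trans y0 yx.
have y1 : 0 < y <= 1 by lra.
have ys : y `^ (s - 1) <= 1.
  by rewrite -[leRHS](powRr0 y); apply: ger_powR => //; lra.
have xx : x * y `^ (s - 1) <= x by rewrite -[leRHS]mulr1 ler_pM2l.
have x01 : 0 < x <= 1 by lra.
rewrite /phi; case: ifP => _; first by lra.
case: ifP => u1; first by apply: (le_trans xx); exact: ger1_powR.
rewrite (_ : u <= 2); last by lra.
by rewrite ler_pM2l//; apply: ger_powR => //; lra.
Qed.

Lemma phi_lt s u x y : 0 < y -> y <= x -> x < 1 -> 1 <= s <= 2 -> s < u ->
  phi u x y < x * y `^ (s - 1).
Proof.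
move=> y0 yx x1 /andP[s1 s2] us; have x0 := lt_le_trans y0 yx.
have y1 : 0 < y < 1 by lra.
rewrite /phi gt_eqF; last by lra.
rewrite leNgt (_ : 1 < u)/=; last by lra.
have [u2|u2] := leP u 2; first by rewrite ltr_pM2l//; apply: powR_gt => //; lra.
apply: (@lt_le_trans _ _ (x * y)).
  have xy : 0 < x * y < 1 by rewrite mulr_gt0//=; nra.
  by rewrite -[ltRHS]powRr1 ?mulr_ge0 ?ltW//; apply: powR_gt => //; lra.
by rewrite ler_pM2l//; apply: ger1_powR; lra.
Qed.

(** Expanding the k-th power of a sum. *)
Lemma sum_tuple_prod (I : finType) (f : I -> R) k :
  \sum_(w : k.-tuple I) \prod_(i <- w) f i = (\sum_i f i) ^+ k.
Proof.
have -> : (\sum_i f i) ^+ k = \prod_(j < k) \sum_i f i by rewrite prodr_const card_ord.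
rewrite bigA_distr_bigA /=.
rewrite (reindex (fun g : {ffun 'I_k -> I} => [tuple g i | i < k])) /=.
  by apply: eq_bigr => g _; rewrite big_map big_enum.
exists (fun w : k.-tuple I => [ffun i => tnth w i]) => [g _|w _].
  by apply/ffunP => i; rewrite ffunE tnth_mktuple.
by apply: eq_from_tnth => i; rewrite tnth_mktuple ffunE.
Qed.

Lemma geometric_eseries_lty (G : R) : 0 <= G ->
  (\sum_(1 <= k <oo) (G ^+ k)%:E < +oo)%E = (G < 1).
Proof.
move=> G0; have t0 k : (0 <= (G ^+ k)%:E)%E by rewrite lee_fin exprn_ge0.
have [G1|G1] := ltP G 1.
  apply: (@le_lt_trans _ _ ((1 - G)^-1)%:E); last exact: ltry.
  apply: lime_le; first by apply: is_cvg_nneseries => k _ _; exact: t0.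
  apply: nearW => n; rewrite sumEFin lee_fin.
  have -> : \sum_(1 <= k < n) G ^+ k = \sum_(0 <= k < n) G ^+ k - (0 < n)%N%:R.
    case: n => [|n]; first by rewrite !big_geq// subr0.
    by rewrite [in RHS]big_nat_recl//= expr0 addrC addKr big_add1.
  rewrite big_mkord -[leRHS]mulr1 ler_pdivlMl ?subr_gt0//.
  have := subrX1 G n; have := exprn_ge0 n G0; have : 0 <= (0 < n)%N%:R :> R by [].
  set z := _%:R; nra.
apply/negbTE; rewrite -leNgt leye_eq; apply/eqP/eqyP => A A0.
have [n An] : exists n : nat, A <= n%:R.
  by exists (Num.Def.archi_bound A); exact/ltW/archi_boundP/ltW.
apply: le_trans (nneseries_lim_ge n.+1 (fun k _ _ => t0 k)).
rewrite sumEFin lee_fin (le_trans An)//.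
have -> : n%:R = \sum_(1 <= k < n.+1) (1 : R).
  by rewrite sumr_const_nat subSS subn0.
by apply: ler_sum => k _; exact: exprn_ege1.
Qed.

End AffinityDimension.

Section AffinityOfDiagonal.
Variables (R : realType) (I : finType) (alpha beta : I -> R).
Hypothesis I_gt0 : (0 < #|I|)%N.
Hypothesis beta_gt0 : forall i, 0 < `|beta i|.
Hypothesis beta_le : forall i, `|beta i| <= `|alpha i|.
Hypothesis alpha_lt1 : forall i, `|alpha i| < 1.

Lemma sing_fun_diag2 u (a b : R) : `|b| <= `|a| -> sing_fun u (diag2 a b) = phi u `|a| `|b|.
Proof. by move=> ba; rewrite /sing_fun /phi sing1_diag2 sing2_diag2 max_l// min_r. Qed.

Lemma sum_sing_fun u k :
  \sum_(w : k.-tuple I) sing_fun u (\prod_(i <- w) diag2 (alpha i) (beta i)) =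
  (\sum_i phi u `|alpha i| `|beta i|) ^+ k.
Proof.
rewrite -sum_tuple_prod; apply: eq_bigr => w _.
rewrite diag2_prod sing_fun_diag2 ?normr_prod ?phi_prod//.
by apply: ler_prod => i _; rewrite normr_ge0 beta_le.
Qed.

(** The sum of phi over the alphabet is 1 at s, at least 1 below s and less
    than 1 above s. *)
Lemma affinity_dim_diag2 s : 1 <= s <= 2 ->
  \sum_i `|alpha i| * `|beta i| `^ (s - 1) = 1 ->
  affinity_dim (fun i => diag2 (alpha i) (beta i)) = s%:E.
Proof.
move=> s12 sum1; have /card_gt0P[i0 _] := I_gt0.
have lty u : (\sum_(1 <= k <oo) (\sum_(w : k.-tuple I)
    sing_fun u (\prod_(i <- w) diag2 (alpha i) (beta i)))%R%:E < +oo)%E =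
    (\sum_i phi u `|alpha i| `|beta i| < 1).
  rewrite -geometric_eseries_lty; last by apply: sumr_ge0 => i _; exact: phi_ge0.
  by congr (_ < _)%E; apply: eq_eseriesr => k _; rewrite sum_sing_fun.
apply/eqP; rewrite eq_le; apply/andP; split.
  apply/lee_addgt0Pr => e e0; rewrite -EFinD; apply: ereal_inf_lbound.
  have se : s < s + e by rewrite ltrDl.
  exists (s + e) => //; split; first by have /andP[] := s12; lra.
  rewrite lty -sum1 (bigD1 i0)//= [ltRHS](bigD1 i0)//= ltr_leD ?phi_lt//.
  by apply: ler_sum => i _; apply/ltW/phi_lt.
apply: le_ereal_inf_tmp => _ [u [u0 +] <-]; rewrite lty lee_fin => Hu.
rewrite leNgt; apply/negP => us; move: Hu; apply/negP; rewrite -leNgt -sum1.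
by apply: ler_sum => i _; apply: phi_ge.
Qed.

End AffinityOfDiagonal.

Theorem corollary2p6 (R : realType) (I : finType)
    (a b : I -> R) (L : I -> 'M[R]_2) (t : I -> 'cV[R]_2) (F : set 'cV[R]_2)
    (s1 : R)
    (A := fun i : I => diag2 (a i) (b i) *m L i)
    (S := fun i : I => affine_map (A i) (t i)) :
  (2 <= #|I|)%N ->
  (forall i, 0 < a i < 1) ->
  (forall i, 0 < b i < 1) ->
  (forall i, square_isometry (L i)) ->
  is_attractor S F ->
  separated_type S ->
  ROSC S ->
  (forall i, horizontal_sing1 (A i) (S i)) ->
  has_box_dim (@real_dist R) (proj1_set F) s1 ->
  exists s : R,
    [/\ \sum_(i : I) sing1 (A i) `^ s1 * sing2 (A i) `^ (s - s1) = 1,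
        forall u : R,
          \sum_(i : I) sing1 (A i) `^ s1 * sing2 (A i) `^ (u - s1) = 1 -> u = s,
        packing_dim (@eucl_dist R 2) F = s%:E,
        has_box_dim (@eucl_dist R 2) F s &
        s1 = 1 -> affinity_dim A = s%:E].
Proof.
move=> I2 a01 b01 isoL [F0 cF FE] sep [x1 [x2 [y1 [y2 [x12 y12 SU Sd]]]]] hor.
move=> /has_box_dimP[proj_le proj_ge].
have I_gt0 : (0 < #|I|)%N by exact: leq_trans I2.
have ex i : exists c : R * R, [/\ A i = diag2 c.1 c.2, `|c.1| = a i & `|c.2| = b i].
  have /andP[ai0 _] := a01 i; have /andP[bi0 _] := b01 i.
  have [alpha [beta H]] := isometry_diagonal ai0 bi0 (isoL i).1 (sep i).
  by exists (alpha, beta).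
have [c cP] := choice ex.
pose alpha i := (c i).1; pose beta i := (c i).2.
have AE : A = fun i => diag2 (alpha i) (beta i) by apply/funext => i; have [] := cP i.
have aE i : `|alpha i| = a i by have [] := cP i.
have bE i : `|beta i| = b i by have [] := cP i.
clearbody alpha beta.
have Sx i p : S i p 0 0 = alpha i * p 0 0 + t i 0 0 by rewrite /S AE affine_diag2_x.
have Sy i p : S i p 1 0 = beta i * p 1 0 + t i 1 0 by rewrite /S AE affine_diag2_y.
have beta_le i : `|beta i| <= `|alpha i|.
  by have := hor i; rewrite /S AE; exact: horizontal_diag2.
have beta_gt0 i : 0 < `|beta i| by rewrite bE; have /andP[] := b01 i.
have beta_neq0 i : beta i != 0 by rewrite -normr_gt0.
have alpha_lt1 i : `|alpha i| < 1 by rewrite aE; have /andP[] := a01 i.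
have sing1E i : sing1 (A i) = `|alpha i| by rewrite AE sing1_diag2 max_l.
have sing2E i : sing2 (A i) = `|beta i| by rewrite AE sing2_diag2 min_r.
have [kappa kappa0 kappa_le] : exists2 kappa, 0 < kappa & forall i, kappa <= `|beta i|.
  have [|k k0 kP] := @pos_lower_bound R I (enum I) (fun i => `|beta i|) _; first by [].
  by exists k => // i; apply: kP; rewrite mem_enum.
have [lambda l01 lambda_ge] : exists2 lambda, 0 < lambda < 1 & forall i, `|alpha i| <= lambda.
  have [|k k0 kP] := @pos_lower_bound R I (enum I) (fun i => 1 - `|alpha i|) _.
    by move=> i _; rewrite subr_gt0.
  exists (Num.max (1 - k) (1 / 2)); first by rewrite lt_max gt_max; lra.
  by move=> i; rewrite le_max; have := kP i; rewrite mem_enum => /(_ isT); lra.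
have [H [Hx Hy]] := compact_plane_bounded cF.
have [||s sE sU] := @dimension_equation R I (fun i => `|alpha i|) (fun i => `|beta i|) s1 I_gt0.
- by move=> i; apply: lt_le_trans (beta_le i).
- by move=> i; rewrite beta_gt0 (le_lt_trans (beta_le i)).
have Fle : box_le (@eucl_dist R 2) F s.
  exact: (box_le_F Sx Sy beta_neq0 beta_le l01 lambda_ge FE Hx Hy
    F0 kappa0 kappa_le sE proj_le).
have Fge : box_ge (@eucl_dist R 2) F s.
  exact: (box_ge_F Sx Sy beta_neq0 beta_le l01 lambda_ge FE Hx Hy
    x12 y12 SU Sd F0 kappa0 kappa_le sE proj_ge).
have s0 := box_le_ge0 F0 Fle.
have singE u : \sum_(i : I) sing1 (A i) `^ s1 * sing2 (A i) `^ (u - s1) =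
    \sum_i `|alpha i| `^ s1 * `|beta i| `^ (u - s1).
  by apply: eq_bigr => i _; rewrite sing1E sing2E.
exists s; split.
- by rewrite singE.
- by move=> u; rewrite singE; exact: sU.
- apply/eqP; rewrite eq_le (packing_dim_le (@eucl_dist0 R) 0 Fle s0)/=.
  exact: (packing_dim_F_ge Sx Sy beta_neq0 beta_le l01 lambda_ge FE Hx Hy
    x12 y12 SU Sd F0 kappa0 kappa_le sE proj_ge (compact_plane_clusters cF)).
- exact/has_box_dimP.
move=> s1E; rewrite AE; apply: affinity_dim_diag2 => //.
  apply/andP; split; last exact: box_dim_le_of Fge (box_le_plane F0 Hx Hy).
  rewrite -s1E; apply: box_dim_le_of Fle.
  by apply: (box_ge_transfer ltr01 _ proj_ge) => d n _; rewrite mul1r; exact: cover_by_proj.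
rewrite -[RHS]sE s1E; by apply: eq_bigr => i _; rewrite powRr1.
Qed.
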